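(* Let $\mathbb{X}$ and $\mathbb{Y}$ be Asplund spaces, let $f:\mathbb{X}\to\mathbb{Y}$ be continuously differentiable and let $g_i:\mathbb{Y}\to\mathbb{R}$ ($i=1,\dots,m$) be continuous convex functions. Let $\varphi_i:=g_i\circ f$, let $A:=\{x\in\mathbb{X}:\varphi_i(x)\le0,\ i=1,\dots,m\}$ be nonempty, and let $\bar x\in A$. Then the convex-composite inequality system $\varphi_1(x)\le0,\dots,\varphi_m(x)\le0$ has a local error bound at $\bar x$ if and only if there exist $\eta,\delta\in(0,+\infty)$ such that for any $x\in A\cap\mathbf{B}(\bar x,\delta)$ and any $x^*\in\hat N(A,x)\cap\mathbf{B}_{\mathbb{X}^*}$, there are multipliers $\lambda_i\in[0,\eta]$, $i\in I(x)$, satisfying $$x^*\in\sum_{i\in I(x)}\lambda_i\hat\partial\varphi_i(x).$$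
   Context: $\mathbb{X}^*$ is the topological dual of $\mathbb{X}$; $\mathbf{B}_{\mathbb{X}^*}$ is the closed unit ball of $\mathbb{X}^*$; $\mathbf{B}(x,r)$ is the open ball with center $x$ and radius $r$; $\mathbf{d}(x,S)=\inf_{y\in S}\|x-y\|$. A real Banach space is Asplund if every continuous convex function on it is Fréchet differentiable at each point of a dense subset. For $x\in A$, $I(x):=\{i:\varphi_i(x)=0\}$ (a sum over an empty index set is $\{0\}$). The system has a local error bound at $\bar x\in A$ if there exist $\eta,\delta\in(0,+\infty)$ such that $\mathbf{d}(x,A)\le\eta\sum_{i=1}^m\max\{\varphi_i(x),0\}$ for all $x\in\mathbf{B}(\bar x,\delta)$. Fréchet normal cone of a closed set $A$ at $x\in A$: $\hat N(A,x)=\{x^*\in\mathbb{X}^*:\limsup_{y\to x,\,y\in A}\frac{\langle x^*,y-x\rangle}{\|y-x\|}\le0\}$. Fréchet subdifferential: $\hat\partial\varphi(x)=\{x^*\in\mathbb{X}^*:\liminf_{y\to x}\frac{\varphi(y)-\varphi(x)-\langle x^*,y-x\rangle}{\|y-x\|}\ge0\}$. *)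

(* Defs.v *)
From HB Require Import structures.
From mathcomp Require Import all_boot all_order all_algebra.
From mathcomp Require Import all_classical all_reals all_analysis.

Set Implicit Arguments.
Unset Strict Implicit.
Unset Printing Implicit Defensive.

Import Order.TTheory GRing.Theory Num.Theory.
Import numFieldNormedType.Exports.

Local Open Scope classical_set_scope.
Local Open Scope ring_scope.

Definition dual (R : realType) (X : normedModType R) : set {linear X -> R^o} :=
  [set l | continuous (l : X -> R^o)].

(* [sup] is 0 on unbounded sets, so this is the operator norm only for bounded
   linear maps; it is only ever used on continuous linear maps and on
   differences of such maps. *)
Definition opnorm (R : realType) (X Y : normedModType R) (L : X -> Y) : R :=
  sup [set `|L u| | u in [set u | `|u| <= 1]].

Definition dual_unit_ball (R : realType) (X : normedModType R) :
    set {linear X -> R^o} :=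
  [set l | dual l /\ opnorm (l : X -> R^o) <= 1].

Definition C1 (R : realType) (X Y : normedModType R) (f : X -> Y) : Prop :=
  (forall x, differentiable f x) /\
  (forall x, opnorm (fun u => 'd f y u - 'd f x u) @[y --> x] --> (0 : R)).

Definition convex_on_space (R : realType) (X : normedModType R) (h : X -> R) :
    Prop :=
  convex_function (setT : set (convex_lmodType X)) h.

Definition asplund (R : realType) (X : completeNormedModType R) : Prop :=
  forall h : X -> R, continuous h -> convex_on_space h ->
    exists2 D : set X, dense D & forall x, D x -> differentiable (h : X -> R^o) x.

Definition dist (R : realType) (X : normedModType R) (x : X) (S : set X) : R :=
  inf [set `|x - y| | y in S].

(* The punctured neighbourhoods [x^'] discard y = x, where the quotient is 0/0.
   If x is isolated in A the upper limit is -oo and the cone is the whole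
   dual. *)
Definition frechet_normal_cone (R : realType) (X : normedModType R)
    (A : set X) (x : X) : set {linear X -> R^o} :=
  [set l | dual l /\
    (limf_esup (fun y : X => (l (y - x) / `|y - x|)%:E) (within A x^') <= 0)%E].

Definition frechet_subdiff (R : realType) (X : normedModType R)
    (phi : X -> R) (x : X) : set {linear X -> R^o} :=
  [set l | dual l /\
    (0 <= limf_einf
            (fun y : X => ((phi y - phi x - l (y - x)) / `|y - x|)%:E) x^')%E].

Definition sublevel_system (R : realType) (X : normedModType R) (m : nat)
    (phi : 'I_m -> X -> R) : set X :=
  [set x | forall i, phi i x <= 0].

Definition active (R : realType) (X : normedModType R) (m : nat)
    (phi : 'I_m -> X -> R) (x : X) : pred 'I_m :=
  fun i => phi i x == 0.

(* The Minkowski sum of the sets lambda i * S i over the indices in P; it is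
   {0} when P is empty. *)
Definition weighted_sum (R : realType) (X : normedModType R) (m : nat)
    (P : pred 'I_m) (lambda : 'I_m -> R) (S : 'I_m -> set {linear X -> R^o}) :
    set {linear X -> R^o} :=
  [set l | exists2 u : 'I_m -> {linear X -> R^o},
    forall i, P i -> S i (u i) &
    forall v, l v = \sum_(i < m | P i) lambda i * u i v].

Definition local_error_bound (R : realType) (X : normedModType R) (m : nat)
    (phi : 'I_m -> X -> R) (xbar : X) : Prop :=
  exists eta delta : R, [/\ 0 < eta, 0 < delta &
    forall x, ball xbar delta x ->
      dist x (sublevel_system phi) <=
        eta * \sum_(i < m) Num.max (phi i x) 0].

(* Main.v *)
(* The multiplier condition implies the error bound through approximate
   projections: if [x] is not in the closed set [A], some [a] in [A] near [x]
   carries a Frechet normal [l] of norm at most 1 with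
   [b * `|x - a| <= l (x - a)], [b < 1]; writing [l] with multipliers and using
   that [g i \o f] is approximately convex ([f] is strictly differentiable and
   [g i] locally Lipschitz) bounds [`|x - a|] by the violation at [x].

   Such an [a] is found without renorming [X].  Membership of [l] in the normal
   cone is, by Hahn-Banach, a condition on finite families of points of [A], so
   that a closed subspace [Z] spanned by countably many witnesses is enough: a
   normal to [A `&` Z] within [Z] yields one to [A] with the same constants.
   Since [X] is Asplund, bounded sets of functionals have small slices for the
   seminorm of uniform convergence on the unit ball of [Z], hence the dual ball
   is separable for it, and penalizing the supremum [`|z| = sup l z] by the
   distances to a dense sequence approximates the norm by convex functions that
   are smooth along [Z].  A Borwein-Preiss argument with these functions gives
   the normal within [Z].

   Conversely, an error bound gives
   [l h <= eta * \sum_i max (phi_i' (x; h)) 0] over the active [i] for each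
   Frechet normal [l] in the unit ball, and the Hahn-Banach theorem splits [l]
   accordingly. *)
Require Import Defs.
From HB Require Import structures.
From mathcomp Require Import all_boot all_order all_algebra.
From mathcomp Require Import all_classical all_reals all_analysis.
From mathcomp Require Import ring lra.

Set Implicit Arguments.
Unset Strict Implicit.
Unset Printing Implicit Defensive.

Import Order.TTheory GRing.Theory Num.Theory.
Import numFieldNormedType.Exports.

Local Open Scope classical_set_scope.
Local Open Scope ring_scope.

Section inf_sup.
Variable R : realType.
Implicit Types E : set R.

Lemma inf_le_mem E b x : lbound E b -> E x -> inf E <= x.
Proof. by move=> lb Ex; apply: ge_inf => //; exists b. Qed.

Lemma le_sup_ub E b x : ubound E b -> E x -> x <= sup E.
Proof. by move=> ub Ex; apply: ub_le_sup => //; exists b. Qed.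

End inf_sup.

(** * Sublinear functionals and the Hahn-Banach theorem *)

Section sublinear.
Variables (R : realType) (X : lmodType R).
Implicit Types (p q : X -> R) (l : X -> R) (K : set (X * R)).

Definition sublinear q :=
  (forall u v, q (u + v) <= q u + q v) /\
  (forall (t : R) v, 0 <= t -> q (t *: v) = t * q v).

(** A predicate on plain functions, so that functionals obtained by formulas or by minimality carry
    no structure; [is_linear_pack] bundles them when needed. *)
Definition is_linear l :=
  (forall u v, l (u + v) = l u + l v) /\
  (forall t v, l (t *: v) = t * l v).

Definition linear_subspace (Z : set X) :=
  [/\ Z 0, forall u v, Z u -> Z v -> Z (u + v) &
      forall t v, Z v -> Z (t *: v)].

Lemma sublinear0 q : sublinear q -> q 0 = 0.
Proof. by move=> [_ h]; rewrite -(scale0r 0) h // mul0r. Qed.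

Lemma sublinearN q u : sublinear q -> - q (- u) <= q u.
Proof.
move=> hq; have := hq.1 u (- u); rewrite subrr (sublinear0 hq); lra.
Qed.

(** The reverse inequality is the assumed one for [t^-1] at [t *: v]. *)
Lemma sublinearZ q : (forall u v, q (u + v) <= q u + q v) -> q 0 = 0 ->
  (forall (t : R) v, 0 < t -> q (t *: v) <= t * q v) -> sublinear q.
Proof.
move=> qD q0 qZ; split => // t v; rewrite le_eqVlt => /orP[/eqP<-|t0].
  by rewrite scale0r mul0r.
apply/eqP; rewrite eq_le qZ //= -ler_pdivlMl //.
have {1}-> : v = t^-1 *: (t *: v) by rewrite scalerA mulVf ?gt_eqF // scale1r.
by apply: qZ; rewrite invr_gt0.
Qed.

Lemma is_linearB l u v : is_linear l -> l (u - v) = l u - l v.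
Proof. by move=> [lD lZ]; rewrite lD -scaleN1r lZ mulN1r. Qed.

Lemma is_linearN l u : is_linear l -> l (- u) = - l u.
Proof. by move=> [lD lZ]; rewrite -scaleN1r lZ mulN1r. Qed.

Lemma is_linear0 l : is_linear l -> l 0 = 0.
Proof. by move=> [lD lZ]; rewrite -(scale0r 0) lZ mul0r. Qed.

(** Zorn's lemma, with pointwise infima as bounds of chains. These are finite because a sublinear
    [s] below [p] satisfies [- p (- v) <= s v]. *)
Lemma minimal_sublinear p (E : set X) (h : X -> R) : sublinear p ->
  (forall z, E z -> h z <= p z) ->
  exists q, [/\ sublinear q, forall v, q v <= p v,
    forall z, E z -> h z <= q z &
    forall q', sublinear q' -> (forall v, q' v <= q v) ->
      (forall z, E z -> h z <= q' z) -> forall v, q v <= q' v].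
Proof.
move=> sp hp.
pose P q := [/\ sublinear q, forall v, q v <= p v & forall z, E z -> h z <= q z].
pose T := {q | P q}.
(* The order is reversed: a maximal element for [r] is a minimal functional. *)
pose r (s t : T) := `[< forall v, sval t v <= sval s v >].
have Pp : P p by split.
have [|||q qmin] := @ZL_preorder T (exist _ p Pp) r.
- by move=> t; apply/asboolP.
- move=> a b c /asboolP ab /asboolP bc; apply/asboolP => v.
  exact: le_trans (bc v) (ab v).
- move=> A Atot; have [[s0 As0]|A0] := pselect (A !=set0); last first.
    by exists (exist _ p Pp) => s As; exfalso; apply: A0; exists s.
  pose q v := inf [set sval s v | s in A].
  have ne v : [set sval s v | s in A] !=set0 by exists (sval s0 v), s0.
  have lbv v : lbound [set sval s v | s in A] (- p (- v)).
    move=> _ [s As <-]; have [ss sp' _] := svalP s.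
    by apply: le_trans (sublinearN v ss); rewrite lerN2.
  have qle s v : A s -> q v <= sval s v.
    by move=> As; apply: inf_le_mem (lbv v) _; exists s.
  have Pq : P q; last first.
    by exists (exist _ q Pq) => s As; apply/asboolP => v; exact: qle.
  split.
  + apply: sublinearZ.
    (* Two members of the chain are comparable, and the smaller one serves for both [u] and [v]. *)
    * move=> u v; rewrite -lerBlDr; apply: lb_le_inf => // _ [s As <-].
      rewrite lerBlDr -lerBlDl; apply: lb_le_inf => // _ [t At <-].
      rewrite lerBlDl; have [/asboolP st|/asboolP ts] := Atot _ _ As At.
      - apply: le_trans (qle t _ At) _; have [tt _ _] := svalP t.
        by apply: le_trans (tt.1 u v) _; rewrite lerD2r st.
      - apply: le_trans (qle s _ As) _; have [tt _ _] := svalP s.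
        by apply: le_trans (tt.1 u v) _; rewrite lerD2l ts.
    * apply/eqP; rewrite eq_le; apply/andP; split.
        have [ss _ _] := svalP s0.
        by rewrite -(sublinear0 ss); exact: qle.
      apply: lb_le_inf => // _ [s As <-]; have [ss _ _] := svalP s.
      by rewrite sublinear0.
    * move=> t v t0; rewrite -ler_pdivrMl //; apply: lb_le_inf => // _ [s As <-].
      rewrite ler_pdivrMl //; have [ss _ _] := svalP s.
      by rewrite -(ss.2 t v (ltW t0)); exact: qle.
  + by move=> v; apply: le_trans (qle _ v As0) _; have [_ ? _] := svalP s0.
  + move=> z Ez; apply: lb_le_inf => // _ [s As <-].
    by have [_ _ hs] := svalP s; exact: hs.
- have [sq qp hq] := svalP q; exists (sval q); split => // q' sq' q'q hq' v.
  have Pq' : P q'.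
    by split => // u; apply: le_trans (q'q u) (qp u).
  have /asboolP : r (exist _ q' Pq') q by apply: qmin; apply/asboolP.
  exact.
Qed.

(* [lower q K] is the largest sublinear functional below [q] with value at most
   [- c] at [- k] for every [(k, c)] in the convex cone [K]. *)
Definition lower q K u := inf [set q (u + k.1) - k.2 | k in K].

(** The last clause makes the constraints compatible with [q]: it bounds the infimum in
    [lower q K u] from below by [- q (- u)]. *)
Definition lowering q K :=
  [/\ K (0, 0), forall k k', K k -> K k' -> K (k.1 + k'.1, k.2 + k'.2),
      forall (t : R) k, 0 < t -> K k -> K (t *: k.1, t * k.2) &
      forall k, K k -> k.2 <= q k.1].

Lemma lower_le q K k u : sublinear q -> lowering q K -> K k ->
  lower q K u <= q (u + k.1) - k.2.
Proof.
move=> sq [K0 KD KZ Kq] Kk; apply: (@inf_le_mem _ _ (- q (- u))); last by exists k.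
move=> _ [k' Kk' <-]; have := Kq _ Kk'; have := sq.1 (u + k'.1) (- u).
by rewrite addrAC subrr add0r; lra.
Qed.

Lemma lower_ge q K u b : K (0, 0) -> (forall k, K k -> b <= q (u + k.1) - k.2) ->
  b <= lower q K u.
Proof.
move=> K0 h; apply: lb_le_inf; first by exists (q (u + 0) - 0), (0, 0).
by move=> _ [k Kk <-]; exact: h.
Qed.

Lemma lower_sublinear q K : sublinear q -> lowering q K -> sublinear (lower q K).
Proof.
move=> sq lK; have [K0 KD KZ Kq] := lK; apply: sublinearZ.
- move=> u v; rewrite -lerBlDr; apply: lower_ge => // k Kk.
  rewrite lerBlDr -lerBlDl; apply: lower_ge => // k' Kk'.
  rewrite lerBlDl; apply: le_trans (lower_le _ sq lK (KD _ _ Kk Kk')) _ => /=.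
  have := sq.1 (u + k.1) (v + k'.1); rewrite addrACA; lra.
- apply/eqP; rewrite eq_le; apply/andP; split.
    have := lower_le 0 sq lK K0; rewrite /= addr0 (sublinear0 sq); lra.
  by apply: lower_ge => // k /Kq; rewrite add0r; lra.
- move=> t v t0; rewrite -ler_pdivrMl //; apply: lower_ge => // k Kk.
  rewrite ler_pdivrMl //; apply: le_trans (lower_le _ sq lK (KZ _ _ t0 Kk)) _.
  by rewrite /= -scalerDr (sq.2 _ _ (ltW t0)) mulrBr.
Qed.

Lemma lower_leq q K u : sublinear q -> lowering q K -> lower q K u <= q u.
Proof.
move=> sq lK; have [K0 _ _ _] := lK.
by have := lower_le u sq lK K0; rewrite /= addr0 subr0.
Qed.

Lemma lowerN q K k : sublinear q -> lowering q K -> K k ->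
  lower q K (- k.1) <= - k.2.
Proof.
move=> sq lK Kk; have := lower_le (- k.1) sq lK Kk.
by rewrite addNr (sublinear0 sq) sub0r.
Qed.

Lemma ray_lowering q v c : sublinear q -> (forall t, 0 <= t -> t * c <= q (t *: v)) ->
  lowering q [set k | exists2 t, 0 <= t & k = (t *: v, t * c)].
Proof.
move=> sq h; split.
- by exists 0; rewrite ?scale0r ?mul0r.
- move=> _ _ [t t0 ->] [s s0 ->] /=; exists (t + s); first exact: addr_ge0.
  by rewrite scalerDl mulrDl.
- move=> s _ s0 [t t0 ->] /=; exists (s * t); first by rewrite mulr_ge0 // ltW.
  by rewrite scalerA mulrA.
- by move=> _ [t t0 ->] /=; exact: h.
Qed.

(** A minimal sublinear [q] is additive: lowering it along the ray of [v] with slope [q v] cannot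
    decrease it, so [q u <= q (u + v) - q v]. *)
Lemma linear_below p : sublinear p ->
  exists2 l, is_linear l & forall v, l v <= p v.
Proof.
move=> sp.
have [|q [sq qp _ qmin]] := @minimal_sublinear p set0 (fun=> 0) sp; first by [].
have qD u v : q (u + v) = q u + q v.
  apply/eqP; rewrite eq_le sq.1 /=.
  pose K := [set k : X * R | exists2 t, 0 <= t & k = (t *: v, t * q v)].
  have lK : lowering q K.
    by apply: ray_lowering => // t t0; rewrite sq.2.
  have := qmin _ (lower_sublinear sq lK) (fun w => lower_leq w sq lK).
  move=> /(_ (fun _ H => False_ind _ H) u) le1.
  have Kv : K (v, q v) by exists 1; rewrite ?scale1r ?mul1r.
  by have := lower_le u sq lK Kv; rewrite /=; lra.
have qN v : q (- v) = - q v.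
  by have := qD v (- v); rewrite subrr (sublinear0 sq); lra.
exists q => //; split => // t v; have [t0|t0] := leP 0 t; first exact: sq.2.
by rewrite -[t in LHS]opprK scaleNr qN sq.2 ?oppr_ge0 ?ltW // mulNr opprK.
Qed.

(** Once [p] is lowered along the ray of [z] with slope [p z], every linear functional below it has
    value at most [- p z] at [- z]. *)
Lemma hahn_banach_point p z : sublinear p ->
  exists l, [/\ is_linear l, forall v, l v <= p v & l z = p z].
Proof.
move=> sp; have lK := ray_lowering (v := z) (c := p z) sp.
have {}lK : lowering p [set k | exists2 t, 0 <= t & k = (t *: z, t * p z)].
  by apply: lK => t t0; rewrite sp.2.
have [l ll lq] := linear_below (lower_sublinear sp lK).
exists l; split => // [v|]; first exact: le_trans (lq v) (lower_leq v sp lK).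
apply/eqP; rewrite eq_le (le_trans (lq z) (lower_leq z sp lK)) /=.
have := lq (- z); rewrite is_linearN //.
have /(lowerN sp lK)/= : [set k | exists2 t, 0 <= t & k = (t *: z, t * p z)] (z, p z).
  by exists 1; rewrite ?scale1r ?mul1r.
by lra.
Qed.

(** The cone used for lowering [p] is the graph of [l] over [Z]. A linear functional below the
    result dominates [l] on [Z], hence equals it there. *)
Lemma hahn_banach p (Z : set X) (l : X -> R) : sublinear p -> linear_subspace Z ->
  (forall u v, Z u -> Z v -> l (u + v) = l u + l v) ->
  (forall t v, Z v -> l (t *: v) = t * l v) ->
  (forall v, Z v -> l v <= p v) ->
  exists L, [/\ is_linear L, forall v, L v <= p v & forall v, Z v -> L v = l v].
Proof.
move=> sp [Z0 ZD ZZ] lD lZ lp.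
pose K := [set k : X * R | exists2 z, Z z & k = (z, l z)].
have lK : lowering p K.
  split.
  - by exists 0 => //; have := lZ 0 0 Z0; rewrite scale0r mul0r => ->.
  - move=> _ _ [u Zu ->] [v Zv ->]; exists (u + v); rewrite ?lD //; exact: ZD.
  - move=> t _ _ [u Zu ->]; exists (t *: u); rewrite ?lZ //; exact: ZZ.
  - by move=> _ [u Zu ->]; exact: lp.
have [L LL Lq] := linear_below (lower_sublinear sp lK).
have le1 v : Z v -> l v <= L v.
  move=> Zv; have := Lq (- v); rewrite is_linearN //.
  have /(lowerN sp lK)/= : K (v, l v) by exists v.
  by lra.
exists L; split => // v; first exact: le_trans (Lq v) (lower_leq v sp lK).
move=> Zv; apply/eqP; rewrite eq_le le1 // andbT.
have := le1 (-1 *: v); rewrite lZ // LL.2 !mulN1r lerN2; apply.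
exact: ZZ.
Qed.

End sublinear.

(** * Slices and separability of the dual ball *)

Section dual_ball.
Variables (R : realType) (X : normedModType R).
Implicit Types (l : X -> R).

(** The dual unit ball in terms of plain functions and without [opnorm]; [dual_unit_ballP] compares
    it with [dual_unit_ball]. *)
Definition dual_ball : set (X -> R) :=
  [set l | is_linear l /\ forall v, l v <= `|v|].

Lemma norm_sublinear (c : R) : 0 <= c -> sublinear (fun v : X => c * `|v|).
Proof.
move=> c0; split=> [u v|t v t0]; last by rewrite normrZ ger0_norm // mulrCA.
by rewrite -mulrDr ler_wpM2l // ler_normD.
Qed.

Lemma dual_ball_linear l : dual_ball l -> is_linear l.
Proof. by case. Qed.

Lemma dual_ball_norm l v : dual_ball l -> `|l v| <= `|v|.
Proof.
move=> [ll lB]; rewrite ler_norml lB andbT lerNl -is_linearN //.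
by rewrite -[`|v|]normrN.
Qed.

Lemma norming_functional z : exists2 l, dual_ball l & l z = `|z|.
Proof.
have sn : sublinear (fun v : X => `|v|).
  by have := norm_sublinear ler01; congr sublinear; apply/funext => v; rewrite mul1r.
by have [l [ll lB lz]] := hahn_banach_point z sn; exists l.
Qed.

Lemma convexP (h : X -> R) : convex_on_space h <->
  forall (t : R) x y, 0 <= t -> t <= 1 ->
    h (t *: x + (1 - t) *: y) <= t * h x + (1 - t) * h y.
Proof.
split=> [hc t x y t0 t1|hc t x y _ _]; last by apply: hc.
have t01 : 0 <= t <= 1 by rewrite t0.
by have /= := hc (Itv01 t0 t1) x y; apply; rewrite in_setE.
Qed.

Lemma lipschitz_continuous (c : R) (h : X -> R) :
  (forall x y, h x - h y <= c * `|x - y|) -> continuous h.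
Proof.
move=> hL x; apply/cvgrPdist_le => e e0.
have c0 : 0 < `|c| + 1 by rewrite ltr_wpDl.
apply/nbhs_normP; exists (e / (`|c| + 1)) => /=; first by rewrite divr_gt0.
move=> y /=; rewrite ltr_pdivlMr // => xy.
have le1 u v : h u - h v <= (`|c| + 1) * `|u - v|.
  apply: le_trans (hL u v) _; apply: ler_wpM2r => //.
  by apply: le_trans (ler_norm c) _; rewrite lerDl.
apply: le_trans (ltW xy); rewrite mulrC ler_norml le1 andbT lerNl opprB.
by rewrite distrC le1.
Qed.

Lemma differentiable_remainder (V : normedModType R) (f : X -> V) x (e : R) :
  differentiable f x -> 0 < e ->
  exists2 d : R, 0 < d & forall v, `|v| < d -> `|f (x + v) - f x - 'd f x v| <= e * `|v|.
Proof.
move=> /diff_locally df e0; move/eqaddoP: df => /(_ _ e0) /nbhs_norm0P[d /= d0 h].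
exists d => // v /h; rewrite /= !fctE /= [v + x]addrC.
by rewrite opprD addrA.
Qed.

End dual_ball.

Section dentability.
Variables (R : realType) (X : completeNormedModType R).
Hypothesis asplundX : asplund X.
Variables (Z : set X) (Gamma : set (X -> R)).
Hypotheses (sZ : linear_subspace Z) (Gamma0 : Gamma !=set0).
Hypothesis GammaB : Gamma `<=` dual_ball (X := X).

(* Passing to a minimal sublinear functional above [sup Gamma] on [Z] is what
   makes a slice cut out by an arbitrary point of [X] contain one that is cut
   out by a point of [Z]. *)
Lemma small_slice (e : R) : 0 < e -> exists z g0 a,
  [/\ Z z, Gamma g0, a < g0 z & forall g, Gamma g -> a < g z ->
      forall v, Z v -> `|g v - g0 v| <= e * `|v|].
Proof.
move=> e0; have [g1 Gg1] := Gamma0; have [Z0 ZD ZZ] := sZ.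
(* [h] is the support function of [Gamma]. Below, [H] is minimal among the sublinear functionals
   that are under the norm and above [h] on [Z]. *)
pose h z := sup [set g z | g in Gamma].
have h0 z : [set g z | g in Gamma] !=set0 by exists (g1 z), g1.
have hub z : ubound [set g z | g in Gamma] `|z|.
  by move=> _ [g /GammaB[_ gB] <-].
have hge g z : Gamma g -> g z <= h z.
  by move=> Gg; apply: (le_sup_ub (hub z)); exists g.
have h_0 : 0 <= h 0.
  by have := hge _ 0 Gg1; rewrite (is_linear0 (dual_ball_linear (GammaB Gg1))).
have sn : sublinear (fun v : X => 1 * `|v|) by apply: norm_sublinear.
have [|H [sH Hn Hh Hmin]] := @minimal_sublinear R X _ Z h sn.
  by move=> z _; rewrite mul1r; exact: ge_sup (h0 z) (hub z).
have HL x y : H x - H y <= 1 * `|x - y|.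
  by apply: le_trans (Hn (x - y)); have := sH.1 (x - y) y; rewrite subrK; lra.
have Hconv : convex_on_space H.
  apply/convexP => t x y t0 t1; apply: le_trans (sH.1 _ _) _.
  by rewrite !sH.2 ?subr_ge0.
have [D Ddense Hdiff] := asplundX (lipschitz_continuous HL) Hconv.
have [x [_ /Hdiff dH]] : setT `&` D !=set0.
  by apply: Ddense; [exists 0|exact: openT].
pose T : X -> R := 'd (H : X -> R^o) x.
have TL : is_linear T by split=> [u v|t v]; rewrite /T ?linearD ?linearZ.
have [d d0 Hd] := differentiable_remainder dH (divr_gt0 e0 (ltr0n R 4)).
(* The margin [e * d / 8] and the remainder [e / 4 * (d / 2)] add up to [e / 2 * (d / 2)], the bound
   wanted at a vector of norm [d / 2]. *)
pose c := H x - e * d / 8.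
have cH : c < H x by rewrite /c gtrBl divr_gt0 ?mulr_gt0.
pose K := [set k : X * R | exists2 t : R, 0 <= t & k = (t *: (- x), t * (- c))].
(* Otherwise [H] lowered to value at most [c] at [x] would still dominate [h] on [Z], and minimality
   would give [H x <= c]. *)
have [z [t [Zz t0 ltc]]] :
    exists z, exists t : R, [/\ Z z, 0 <= t & H (z - t *: x) + t * c < h z].
  have [lK|nlK] := pselect (forall t : R, 0 <= t -> t * (- c) <= H (t *: (- x))).
    have {}lK := ray_lowering sH lK.
    apply: contrapT => nex; move: cH; apply/negP; rewrite -leNgt.
    have : lower H K x <= c.
      have /(lowerN sH lK) /= : K (- x, - c) by exists 1; rewrite ?scale1r ?mul1r.
      by rewrite !opprK.
    apply: le_trans; apply: (Hmin _ (lower_sublinear sH lK)).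
      by move=> v; exact: lower_leq.
    move=> z Zz; apply: lower_ge; first by case: lK.
    move=> _ [t t0 ->] /=; rewrite leNgt; apply/negP => lt.
    by apply: nex; exists z, t; split => //; move: lt; rewrite scalerN mulrN opprK.
  (* Here the ray is not compatible with [H], and [z = 0] works because [0 <= h 0]. *)
  have /existsNP[t /not_implyP[t0 /negP]] := nlK; rewrite -ltNge => lt.
  exists 0, t; split => //; rewrite sub0r; apply: lt_le_trans h_0.
  by move: lt; rewrite scalerN; lra.
have [_ [g0 Gg0 <-] ag0] := sup_gt (h0 z) ltc.
exists z, g0, (H (z - t *: x) + t * c).
have key g : Gamma g -> H (z - t *: x) + t * c < g z ->
    forall v, Z v -> `|g v - T v| <= e / 2 * `|v|.
  move=> Gg ag; have [gD gZ] := dual_ball_linear (GammaB Gg).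
  (* [g] is known to be below [H] on [Z] only, so it is replaced by an extension [L] below [H]
     everywhere. The slice inequality then forces [c < L x], and differentiability of [H] at [x]
     puts [L] near [T]. *)
  have [L [LL LH LZ]] := hahn_banach sH sZ (fun u v _ _ => gD u v)
    (fun t v _ => gZ t v) (fun v Zv => le_trans (hge _ _ Gg) (Hh _ Zv)).
  have cL : c < L x.
    have := LH (z - t *: x); rewrite is_linearB // LL.2 LZ // => le1.
    have : t * c < t * L x by lra.
    have [->|tn] := eqVneq t 0; first by rewrite !mul0r ltxx.
    by rewrite ltr_pM2l // lt_neqAle eq_sym tn.
  have LT v : L v - T v <= e / 2 * `|v|.
    have [->|v0] := eqVneq v 0.
      by rewrite (is_linear0 LL) (is_linear0 TL) normr0 mulr0 subr0.
    have nv : 0 < `|v| by rewrite normr_gt0.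
    pose s : R := d / 2 / `|v|.
    have s0 : 0 < s by rewrite !divr_gt0.
    have nsv : `|s *: v| = d / 2.
      by rewrite normrZ gtr0_norm // /s divfK // gt_eqF.
    have := Hd (s *: v); rewrite nsv => /(_ _)/le_trans-/(_ _ _ (lexx _)) Hsv.
    have {}Hsv : `|H (x + s *: v) - H x - T (s *: v)| <= e / 4 * (d / 2).
      by apply: Hsv; rewrite ltr_pdivrMr // ltr_pMr // ltr1n.
    have := le_trans (ler_norm _) Hsv; have := LH (x + s *: v).
    rewrite LL.1 LL.2 TL.2.
    move=> le1 le2.
    rewrite -(ler_pM2l s0) mulrBr mulrCA /s divfK ?gt_eqF // -/s.
    by move: cL; rewrite /c; lra.
  move=> v Zv; rewrite -LZ // ler_norml LT andbT.
  by have := LT (- v); rewrite (is_linearN _ LL) (is_linearN _ TL) normrN; lra.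
split => // g Gg ag v Zv.
have := key g Gg ag v Zv; have := key g0 Gg0 ag0 v Zv.
rewrite !ler_norml => /andP[? ?] /andP[? ?]; apply/andP; split; lra.
Qed.

End dentability.

Section ball_separable.
Variables (R : realType) (X : completeNormedModType R).
Hypothesis asplundX : asplund X.
Variables (Z : set X) (D : nat -> X).
Hypothesis sZ : linear_subspace Z.
Hypothesis DZ : forall z, Z z -> forall e : R, 0 < e -> exists n, `|z - D n| < e.

(* The slices with rational data that are covered by countably many small balls
   have a countably covered union, and whatever they miss would have a small
   slice, itself contained in such a slice. *)
Lemma dual_ball_countable_net (e : R) : 0 < e -> exists E : set (X -> R),
  [/\ countable E, E `<=` dual_ball (X := X) & forall l, dual_ball l ->
    exists2 x, E x & forall v, Z v -> `|l v - x v| <= e * `|v|].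
Proof.
move=> e0; pose covers (E U : set (X -> R)) := forall l, U l ->
  exists2 x, E x & forall v, Z v -> `|l v - x v| <= e * `|v|.
pose good U := exists E : set (X -> R),
  [/\ countable E, E `<=` dual_ball (X := X) & covers E U].
pose S (iq : nat * rat) : set (X -> R) :=
  [set l | dual_ball l /\ ratr iq.2 < l (D iq.1)].
have [iq|F FP] := @choice (nat * rat) (set (X -> R)) (fun iq E => countable E /\
    E `<=` dual_ball (X := X) /\ (good (S iq) -> covers E (S iq))).
  have [[E [Ec EB EU]]|ng] := pselect (good (S iq)).
    by exists E; split => //; split.
  by exists set0; split; [exact: countable0|split => // /ng].
pose E := \bigcup_(iq in [set: nat * rat]) F iq.
have Ec : countable E.
  by apply: bigcup_countable => [|i _]; [exact: countableP|case: (FP i)].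
have EB : E `<=` dual_ball (X := X).
  by move=> l [iq _ Fl]; have [_ [FB _]] := FP iq; exact: FB.
pose C := [set l | exists2 iq, good (S iq) & S iq l].
have EC : covers E C.
  move=> l [iq gS Sl]; have [_ [_ /(_ gS)]] := FP iq.
  by move=> /(_ _ Sl)[x Fx xP]; exists x => //; exists iq.
exists E; split => // l lB; apply: (EC); apply: contrapT => nCl.
pose Gamma := dual_ball (X := X) `\` C.
have GB : Gamma `<=` dual_ball (X := X) by move=> ? [].
have [|z [g0 [a [Zz [g0B nCg0] ag0 Hs]]]] :=
    @small_slice _ _ asplundX _ _ sZ _ GB _ e0; first by exists l.
(* Replacing [z] by [D n] costs less than [t], and [q] lies between [a + t] and [a + 2 * t]. As
   [g0 z = a + 4 * t], the rational slice contains [g0], and all its members satisfy [a < g z]. *)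
apply: nCg0; pose t := (g0 z - a) / 4.
have t0 : 0 < t by rewrite divr_gt0 // subr_gt0.
have [n zn] := DZ Zz t0.
have [|q] := @rat_in_itvoo R (a + t) (a + 2 * t); first by lra.
rewrite in_itv /= => /andP[q1 q2].
have close g : dual_ball g -> `|g z - g (D n)| < t.
  move=> gB; rewrite -is_linearB; last exact: dual_ball_linear.
  by apply: le_lt_trans (dual_ball_norm _ gB) zn.
have Sg0 : S (n, q) g0.
  split => //=; have := close _ g0B; rewrite ltr_norml => /andP[_].
  by rewrite /t in q2 *; lra.
(* In this slice [E] covers the members of [C], and the single functional [g0] covers all others. *)
exists (n, q) => //; exists (E `|` [set g0]); split.
- rewrite -bigcup2E; apply: bigcup_countable; first exact: countableP.
  by case=> [|[|i]] _ /=.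
- by move=> x [|->] //; exact: EB.
- move=> g [gB /= qg]; have [Cg|nCg] := pselect (C g).
    by have [x Ex xP] := EC _ Cg; exists x => //; left.
  exists g0; [by right|]; apply: Hs => //.
  have := close _ gB; rewrite ltr_norml => /andP[].
  by rewrite /t in q1 *; lra.
Qed.

Lemma dual_ball_separable : exists xs : nat -> X -> R,
  (forall n, dual_ball (xs n)) /\
  forall l (e : R), dual_ball l -> 0 < e ->
    exists n, forall v, Z v -> `|l v - xs n v| <= e * `|v|.
Proof.
have [n|F FP] := @choice nat (set (X -> R)) (fun n E => [/\ countable E,
    E `<=` dual_ball (X := X) & forall l, dual_ball l ->
    exists2 x, E x & forall v, Z v -> `|l v - x v| <= n.+1%:R^-1 * `|v|]).
  by apply: dual_ball_countable_net; rewrite invr_gt0.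
pose E := \bigcup_(n in [set: nat]) F n.
have Ec : countable E.
  by apply: bigcup_countable => [|i _]; [exact: countableP|case: (FP i)].
have EB : E `<=` dual_ball (X := X).
  by move=> l [n _ Fl]; have [_ FB _] := FP n; exact: FB.
have [l0 l0B _] := norming_functional (0 : X).
have /pfcard_geP[E0|[xs]] : (E #<= [set: nat])%card by exact: Ec.
  have [_ _ /(_ _ l0B)[x Fx _]] := FP 0%N.
  by have : E x by [exists 0%N]; rewrite E0.
exists xs; split=> [n|l e lB e0].
  by apply: EB; apply: (@funS _ _ _ _ xs).
have [n ne] : exists n, n.+1%:R^-1 < e :> R.
  by have [N _ /(_ _ (leqnn N))] := near_infty_natSinv_lt (PosNum e0); exists N.
have [_ _ /(_ _ lB)[x Fx xP]] := FP n.
have /(@surj _ _ _ _ xs)[k _ kx] : E x by exists n.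
exists k => v Zv; rewrite kx; apply: le_trans (xP _ Zv) _.
by rewrite ler_wpM2r // ltW.
Qed.

End ball_separable.

(** * Smooth approximation of the norm *)

Section smooth_norm.
Variables (R : realType) (X : normedModType R).
Variables (Z : set X) (xs : nat -> X -> R).
Hypothesis sZ : linear_subspace Z.
Hypothesis xsB : forall n, dual_ball (xs n).
Hypothesis xs_net : forall l (e : R), dual_ball l -> 0 < e ->
  exists n, forall v, Z v -> `|l v - xs n v| <= e * `|v|.
Implicit Types (l : X -> R) (z v : X) (n M : nat) (k : R).

Let B := dual_ball (X := X).

(** The set of the [v] is symmetric, so for linear [l] in the ball this is the distance from [l] to
    [xs n] in the norm of functionals restricted to [Z]. *)
Definition gap n l := sup [set l v - xs n v | v in [set v | Z v /\ `|v| <= 1]].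

Lemma gap_ne n l : [set l v - xs n v | v in [set v | Z v /\ `|v| <= 1]] !=set0.
Proof.
by have [Z0 _ _] := sZ; exists (l 0 - xs n 0), 0 => //=; rewrite normr0.
Qed.

Lemma gap_ub n l : B l ->
  ubound [set l v - xs n v | v in [set v | Z v /\ `|v| <= 1]] 2.
Proof.
move=> lB _ [v [Zv v1] <-].
have := dual_ball_norm v lB; have := dual_ball_norm v (xsB n).
by rewrite !ler_norml => /andP[? ?] /andP[? ?]; lra.
Qed.

Lemma gap_ge n l v : B l -> Z v -> l v - xs n v <= gap n l * `|v|.
Proof.
move=> lB Zv; have [lD lZ] := dual_ball_linear lB.
have [xD xZ] := dual_ball_linear (xsB n).
have [->|v0] := eqVneq v 0.
  by rewrite -(scale0r 0) lZ xZ scale0r normr0 !mul0r mulr0 subr0.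
have nv : 0 < `|v| by rewrite normr_gt0.
rewrite -ler_pdivrMr // mulrC mulrBr -lZ -xZ.
apply: le_sup_ub (gap_ub lB) _; exists (`|v|^-1 *: v) => //=; split.
  by have [_ _ ZZ] := sZ; exact: ZZ.
by rewrite normrZ normfV normr_id mulVf ?gt_eqF.
Qed.

Lemma gap_le n l (e : R) : 0 <= e ->
  (forall v, Z v -> l v - xs n v <= e * `|v|) -> gap n l <= e.
Proof.
move=> e0 h; apply: ge_sup; first exact: gap_ne.
by move=> _ [v [Zv v1] <-]; apply: le_trans (h _ Zv) _; rewrite ler_piMr.
Qed.

Lemma gap_ge0 n l : B l -> 0 <= gap n l.
Proof.
move=> lB; have [Z0 _ _] := sZ.
apply: le_sup_ub (gap_ub lB) _; exists 0 => /=; first by rewrite normr0.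
by rewrite (is_linear0 (dual_ball_linear lB))
  (is_linear0 (dual_ball_linear (xsB n))) subrr.
Qed.

Lemma gap_le2 n l : B l -> gap n l <= 2.
Proof. by move=> lB; apply: ge_sup (gap_ub lB); exact: gap_ne. Qed.

Definition midpoint l l' : X -> R := fun v => (l v + l' v) / 2.

Lemma midpoint_ball l l' : B l -> B l' -> B (midpoint l l').
Proof.
move=> lB lB'; have [lD lZ] := dual_ball_linear lB.
have [lD' lZ'] := dual_ball_linear lB'.
split; first split.
- by move=> u v; rewrite /midpoint lD lD'; lra.
- by move=> t v; rewrite /midpoint lZ lZ'; lra.
- move=> v; have := dual_ball_norm v lB; have := dual_ball_norm v lB'.
  by rewrite !ler_norml /midpoint => /andP[? ?] /andP[? ?]; lra.
Qed.

Lemma gap_midpoint n l l' : B l -> B l' ->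
  gap n (midpoint l l') <= (gap n l + gap n l') / 2.
Proof.
move=> lB lB'; apply: gap_le.
  by rewrite divr_ge0 // addr_ge0 // gap_ge0.
move=> v Zv; have := gap_ge n lB Zv; have := gap_ge n lB' Zv.
by rewrite /midpoint; lra.
Qed.

Definition weight n : R := 2^-1 ^+ n.+1.

Lemma weight_gt0 n : 0 < weight n.
Proof. by rewrite exprn_gt0. Qed.

Lemma sum_weight M : \sum_(n < M) weight n = 1 - 2^-1 ^+ M.
Proof.
elim: M => [|M ih]; first by rewrite big_ord0 expr0 subrr.
by rewrite big_ord_recr /= ih /weight exprS; lra.
Qed.

Definition partial_penalty M l := \sum_(n < M) weight n * gap n l ^+ 2.

Lemma partial_penalty_le4 M l : B l -> partial_penalty M l <= 4.
Proof.
move=> lB; apply: (@le_trans _ _ (\sum_(n < M) weight n * 4)).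
  apply: ler_sum => n _; apply: ler_wpM2l; first exact/ltW/weight_gt0.
  have := gap_ge0 n lB; have := gap_le2 n lB; nra.
rewrite -mulr_suml sum_weight.
have : 0 <= 2^-1 ^+ M :> R by rewrite exprn_ge0.
lra.
Qed.

Lemma partial_penalty_mono M M' l : (M <= M')%N ->
  partial_penalty M l <= partial_penalty M' l.
Proof.
move=> /subnKC <-; elim: (M' - M)%N => [|j ih]; first by rewrite addn0.
rewrite addnS; apply: le_trans ih _; rewrite /partial_penalty big_ord_recr /=.
by rewrite lerDl mulr_ge0 ?sqr_ge0 // ltW // weight_gt0.
Qed.

(* A countable sum of squared [Z]-distances to a dense sequence: its defect of
   midpoint convexity controls every [gap n] at once, which is what makes the
   supremum [snorm] Frechet smooth along [Z]. *)
Definition penalty l := sup (range (partial_penalty ^~ l)).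

Lemma penalty_ge M l : B l -> partial_penalty M l <= penalty l.
Proof.
move=> lB; apply: (@le_sup_ub _ _ 4); last by exists M.
by move=> _ [M' _ <-]; exact: partial_penalty_le4.
Qed.

Lemma penalty_le l b : (forall M, partial_penalty M l <= b) -> penalty l <= b.
Proof.
move=> h; apply: ge_sup; first by exists (partial_penalty 0 l), 0%N.
by move=> _ [M _ <-].
Qed.

Lemma penalty_le4 l : B l -> penalty l <= 4.
Proof. by move=> lB; apply: penalty_le => M; exact: partial_penalty_le4. Qed.

Lemma penalty_ge0 l : B l -> 0 <= penalty l.
Proof.
by move=> lB; apply: le_trans (penalty_ge 0 lB); rewrite /partial_penalty big_ord0.
Qed.

(** Each [gap j] is convex and nonnegative, and the square of a mean is the mean of the squares
    minus a quarter of the squared difference. Only the defect of the index [n] is kept. *)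
Lemma penalty_midpoint n l l' : B l -> B l' -> penalty (midpoint l l') <=
  (penalty l + penalty l') / 2 - weight n * (gap n l - gap n l') ^+ 2 / 4.
Proof.
move=> lB lB'; apply: penalty_le => M.
(* The sum is lengthened so that the index [n] occurs in it. *)
apply: le_trans (partial_penalty_mono _ (leq_addl n.+1 M)) _.
set M' := (n.+1 + M)%N; have nM : (n < M')%N by rewrite /M' addSn ltnS leq_addr.
apply: (@le_trans _ _ ((partial_penalty M' l + partial_penalty M' l') / 2 -
    weight n * (gap n l - gap n l') ^+ 2 / 4)); last first.
  by have := penalty_ge M' lB; have := penalty_ge M' lB'; lra.
have -> : (partial_penalty M' l + partial_penalty M' l') / 2 =
    \sum_(j < M') weight j * ((gap j l ^+ 2 + gap j l' ^+ 2) / 2).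
  rewrite /partial_penalty -big_split /= mulr_suml; apply: eq_bigr => j _; lra.
rewrite /partial_penalty (bigD1 (Ordinal nM)) //= [leRHS](_ : _ =
  (weight n * ((gap n l ^+ 2 + gap n l' ^+ 2) / 2) -
    weight n * (gap n l - gap n l') ^+ 2 / 4) +
  \sum_(j < M' | j != Ordinal nM)
    weight j * ((gap j l ^+ 2 + gap j l' ^+ 2) / 2)); last first.
  by rewrite (bigD1 (Ordinal nM)) //= addrAC.
have sq j : gap j (midpoint l l') ^+ 2 <=
    (gap j l ^+ 2 + gap j l' ^+ 2) / 2 - (gap j l - gap j l') ^+ 2 / 4.
  have := gap_midpoint j lB lB'; have := gap_ge0 j (midpoint_ball lB lB').
  nra.
apply: lerD.
  rewrite -mulrA -mulrBr ler_pM2l ?weight_gt0 //.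
apply: ler_sum => j _; rewrite ler_pM2l ?weight_gt0 //.
by apply: le_trans (sq j) _; rewrite gerBl divr_ge0 // sqr_ge0.
Qed.

(** For [k = 0] this would be the norm, by [norming_functional]. The penalty lies in [[0, 4]], so
    for positive [k] the two differ by at most [4 * k]. *)
Definition snorm k z := sup [set l z - k * penalty l | l in dual_ball (X := X)].

Lemma snorm_ne k z : [set l z - k * penalty l | l in dual_ball (X := X)] !=set0.
Proof. by exists (xs 0 z - k * penalty (xs 0)), (xs 0). Qed.

Section fixed_parameter.
Variable k : R.
Hypothesis k0 : 0 < k.

Lemma snorm_ub z : ubound [set l z - k * penalty l | l in dual_ball (X := X)] `|z|.
Proof.
move=> _ [l lB <-]; have := dual_ball_norm z lB; rewrite ler_norml => /andP[_].
have : 0 <= k * penalty l by rewrite mulr_ge0 ?penalty_ge0 // ltW.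
lra.
Qed.

Lemma snorm_ge z l : B l -> l z - k * penalty l <= snorm k z.
Proof. by move=> lB; apply: le_sup_ub (@snorm_ub z) _; exists l. Qed.

Lemma snorm_le_norm z : snorm k z <= `|z|.
Proof. exact: ge_sup (snorm_ne k z) (@snorm_ub z). Qed.

Lemma norm_le_snorm z : `|z| - 4 * k <= snorm k z.
Proof.
have [l lB <-] := norming_functional z; apply: le_trans (snorm_ge z lB).
by rewrite lerD2l lerN2 mulrC ler_wpM2r ?penalty_le4 // ltW.
Qed.

Lemma snorm_approx z (r : R) : 0 < r ->
  exists2 l, B l & snorm k z - r < l z - k * penalty l.
Proof.
move=> r0; have [||_ [l lB <-] h] := @sup_gt R
  [set l z - k * penalty l | l in dual_ball (X := X)] (snorm k z - r).
- exact: snorm_ne.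
- by rewrite /snorm gtrBl.
- by exists l.
Qed.

Lemma snorm_lip z z' : snorm k z - snorm k z' <= `|z - z'|.
Proof.
rewrite lerBlDr; apply: ge_sup; first exact: snorm_ne.
move=> _ [l lB <-]; have := snorm_ge z' lB; have := dual_ball_norm (z - z') lB.
rewrite is_linearB ?ler_norml; last exact: dual_ball_linear.
by move=> /andP[? ?]; lra.
Qed.

Lemma snorm_convex (t : R) z z' : 0 <= t -> t <= 1 ->
  snorm k (t *: z + (1 - t) *: z') <= t * snorm k z + (1 - t) * snorm k z'.
Proof.
move=> t0 t1; apply: ge_sup; first exact: snorm_ne.
move=> _ [l lB <-]; have [-> lZ] := dual_ball_linear lB; rewrite !lZ.
by have := snorm_ge z lB; have := snorm_ge z' lB; nra.
Qed.

Definition near_max z (t : R) : set (X -> R) :=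
  [set l | B l /\ snorm k z - t <= l z - k * penalty l].

(** The midpoint of two near-maximizers gains [k] times the convexity defect of the penalty over
    their mean value, and cannot exceed the supremum. The defect is therefore at most [t / k]. *)
Lemma near_max_gap z n (e : R) : 0 < e -> exists2 t : R, 0 < t &
  forall l l', near_max z t l -> near_max z t l' -> `|gap n l - gap n l'| <= e.
Proof.
move=> e0; exists (k * weight n * e ^+ 2 / 4).
  by rewrite divr_gt0 // mulr_gt0 ?exprn_gt0 // mulr_gt0 // weight_gt0.
move=> l l' [lB h] [lB' h'].
have := snorm_ge z (midpoint_ball lB lB').
have : k * penalty (midpoint l l') <= k * ((penalty l + penalty l') / 2 -
    weight n * (gap n l - gap n l') ^+ 2 / 4).
  by rewrite ler_pM2l // penalty_midpoint.
rewrite /midpoint => h1 h2.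
have : k * weight n * (gap n l - gap n l') ^+ 2 <= k * weight n * e ^+ 2.
  by lra.
rewrite ler_pM2l ?mulr_gt0 ?weight_gt0 //
  -[X in X <= _]real_normK ?num_real //.
by rewrite ler_sqr // nnegrE ltW.
Qed.

Lemma near_max_ne z (t : R) : 0 < t -> near_max z t !=set0.
Proof. by move=> /(snorm_approx z)[l lB h]; exists l; split => //; exact: ltW. Qed.

Lemma near_max_mono z (t t' : R) : t <= t' -> near_max z t `<=` near_max z t'.
Proof. by move=> tt' l [lB h]; split => //; lra. Qed.

(** This stands in for weak-star compactness. The support functions [Q t] of the near-maximizers
    decrease with [t] to a sublinear [q]; a linear [w] below [q] acts as a cluster point, along
    which each [gap n] is lower semicontinuous. *)
Lemma snorm_attained z : exists2 w, B w & snorm k z <= w z - k * penalty w.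
Proof.
pose Q (t : R) v := sup [set l v | l in near_max z t].
have Qne t v : 0 < t -> [set l v | l in near_max z t] !=set0.
  by move=> /(near_max_ne z)[l ll]; exists (l v), l.
have Qub t v : ubound [set l v | l in near_max z t] `|v|.
  by move=> _ [l [lB _] <-]; apply: le_trans (dual_ball_norm v lB); exact: ler_norm.
have Qge t v l : near_max z t l -> l v <= Q t v.
  by move=> ll; apply: le_sup_ub (Qub t v) _; exists l.
have Qmono t t' v : 0 < t -> t <= t' -> Q t v <= Q t' v.
  move=> t0 tt'; apply: ge_sup; first exact: Qne.
  by move=> _ [l ll <-]; apply: Qge; exact: near_max_mono ll.
pose q v := inf [set Q t v | t in [set t | 0 < t]].
have qne v : [set Q t v | t in [set t | 0 < t]] !=set0 by exists (Q 1 v), 1 => /=.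
have qle t v : 0 < t -> q v <= Q t v.
  move=> t0; apply: (@inf_le_mem _ _ (- `|v|)); last by exists t.
  move=> _ [s s0 <-]; have [l ll] := near_max_ne z s0.
  have [lB _] := ll; apply: le_trans (Qge _ v _ ll).
  by have := dual_ball_norm v lB; rewrite ler_norml => /andP[].
have sq : sublinear q.
  apply: sublinearZ.
  - move=> u v; rewrite -lerBlDr; apply: lb_le_inf => // _ [t t0 <-].
    rewrite lerBlDr -lerBlDl; apply: lb_le_inf => // _ [s s0 <-]; rewrite lerBlDl.
    have r0 : 0 < Num.min t s by rewrite lt_min t0.
    apply: le_trans (qle _ _ r0) _; apply: ge_sup; first exact: Qne.
    move=> _ [l ll <-]; have [lB _] := ll; have [-> _] := dual_ball_linear lB.
    apply: lerD; apply: Qge; apply: near_max_mono ll; first by rewrite ge_min lexx.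
    by rewrite ge_min lexx orbT.
  - apply/eqP; rewrite eq_le; apply/andP; split.
      apply: le_trans (qle _ _ ltr01) _; apply: ge_sup; first exact: Qne.
      by move=> _ [l [lB _] <-]; rewrite is_linear0 //; exact: dual_ball_linear.
    apply: lb_le_inf => // _ [t t0 <-]; have [l ll] := near_max_ne z t0.
    apply: le_trans (Qge _ _ _ ll); case: ll => lB _.
    by rewrite is_linear0 //; exact: dual_ball_linear.
  - move=> s v s0; rewrite -ler_pdivrMl //; apply: lb_le_inf => // _ [t t0 <-].
    rewrite ler_pdivrMl //; apply: le_trans (qle _ _ t0) _.
    apply: ge_sup; first exact: Qne.
    move=> _ [l ll <-]; have [lB _] := ll; have [_ ->] := dual_ball_linear lB.
    by rewrite ler_pM2l //; exact: Qge.
have [w lw wq] := linear_below sq.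
have wQ t v : 0 < t -> w v <= Q t v by move=> t0; exact: le_trans (wq v) (qle _ _ t0).
have wB : B w.
  by split => // v; apply: le_trans (wQ _ v ltr01) _; exact: ge_sup (Qne _ _ _) (Qub _ _).
(* On [Z], [w] is below the supremum of the near-maximizers, whose [gap n] are nearly equal. *)
have gapw n (e : R) : 0 < e -> exists2 t : R, 0 < t &
    forall l, near_max z t l -> gap n w <= gap n l + e.
  move=> e0; have [t t0 ht] := near_max_gap z n e0; exists t => // l ll.
  have [lB _] := ll; apply: gap_le; first by rewrite addr_ge0 ?gap_ge0 // ltW.
  move=> v Zv; rewrite lerBlDr; apply: le_trans (wQ _ v t0) _.
  apply: ge_sup; first exact: Qne.
  move=> _ [l' ll' <-]; have [lB' _] := ll'; rewrite -lerBlDr.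
  apply: le_trans (gap_ge n lB' Zv) _; apply: ler_wpM2r => //.
  by have := ht _ _ ll' ll; rewrite ler_norml => /andP[_]; lra.
have partw M (e : R) : 0 < e -> exists2 t : R, 0 < t &
    forall l, near_max z t l -> partial_penalty M w <= partial_penalty M l + e.
  elim: M e => [e e0|M ih e e0].
    by exists 1 => // l _; rewrite /partial_penalty !big_ord0 add0r ltW.
  have [t t0 ht] := ih (e / 2) (divr_gt0 e0 (ltr0n _ 2)).
  (* With gaps at most 2 and [e' <= 1], squaring [gap M l + e'] adds at most [5 * e'], that is at
     most [e / 2]. *)
  pose e' : R := Num.min 1 (e / 10).
  have e'0 : 0 < e' by rewrite lt_min ltr01 divr_gt0.
  have [s s0 hs] := gapw M e' e'0.
  exists (Num.min t s); first by rewrite lt_min t0.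
  move=> l ll; have lt : near_max z t l.
    by apply: near_max_mono ll; rewrite ge_min lexx.
  have ls : near_max z s l by apply: near_max_mono ll; rewrite ge_min lexx orbT.
  have [lB _] := ll.
  rewrite /partial_penalty !big_ord_recr /= -!/(partial_penalty _ _).
  have e1 : e' <= 1 by rewrite ge_min lexx.
  have e2 : e' <= e / 10 by rewrite ge_min lexx orbT.
  have gsq : gap M w ^+ 2 <= gap M l ^+ 2 + e / 2.
    have := hs _ ls; have := gap_ge0 M wB; have := gap_le2 M lB.
    have := gap_ge0 M lB; nra.
  have w1 : weight M <= 1 by apply: exprn_ile1; lra.
  have : weight M * gap M w ^+ 2 <= weight M * gap M l ^+ 2 + e / 2.
    apply: le_trans (ler_wpM2l (ltW (weight_gt0 M)) gsq) _.
    by rewrite mulrDr lerD2l ler_piMl // divr_ge0 // ltW.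
  by have := ht _ lt; lra.
exists w => //.
suff : penalty w <= (w z - snorm k z) / k.
  by rewrite ler_pdivlMr // mulrC; lra.
apply: penalty_le => M; rewrite ler_pdivlMr // mulrC.
apply/ler_addgt0Pl => e e0.
have [t t0 ht] := partw M (e / 2 / k) (divr_gt0 (divr_gt0 e0 (ltr0n _ 2)) k0).
pose s := Num.min t (e / 2).
have s0 : 0 < s by rewrite lt_min t0 divr_gt0.
(* At [- z] the upper bound by [Q s] is a lower bound for [w z]. *)
have := wQ _ (- z) s0; rewrite is_linearN // => h.
suff : Q s (- z) <= - (snorm k z - e / 2 + k * partial_penalty M w - e / 2) by lra.
apply: ge_sup; first exact: Qne.
move=> _ [l ll <-]; have [lB hl] := ll.
have lt : near_max z t l by apply: near_max_mono ll; rewrite ge_min lexx.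
have := ht _ lt; rewrite -(ler_pM2l k0) mulrDr [k * (_ / k)]mulrC divfK ?gt_eqF //.
have : k * partial_penalty M l <= k * penalty l by rewrite ler_pM2l // penalty_ge.
have : s <= e / 2 by rewrite ge_min lexx orbT.
rewrite is_linearN; last exact: dual_ball_linear.
lra.
Qed.

(* Smulian's test: near-maximizers of the supremum defining [snorm] are close
   to each other on [Z]. *)
Lemma near_max_close z (e : R) : 0 < e -> exists2 t : R, 0 < t &
  forall l l', near_max z t l -> near_max z t l' ->
    forall v, Z v -> l v - l' v <= e * `|v|.
Proof.
move=> e0; have [w wB hw] := snorm_attained z.
have e40 : 0 < e / 4 by rewrite divr_gt0.
(* [xs n] is close to the maximizer [w]; near-maximizers have almost the same [gap n], so they are
   all close to [xs n] on [Z]. *)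
have [n hn] := xs_net wB e40.
have gw : gap n w <= e / 4.
  by apply: gap_le (ltW e40) _ => v Zv; apply: le_trans (ler_norm _) (hn _ Zv).
have [t t0 ht] := near_max_gap z n e40.
have wt : near_max z t w by split => //; lra.
have half l v : near_max z t l -> Z v -> l v - xs n v <= e / 2 * `|v|.
  move=> ll Zv; have [lB _] := ll; apply: le_trans (gap_ge n lB Zv) _.
  apply: ler_wpM2r => //; have := ht _ _ ll wt; rewrite ler_norml.
  by move=> /andP[_]; lra.
exists t => // l l' ll ll' v Zv; have [_ _ ZZ] := sZ.
have := half _ _ ll Zv; have := half _ _ ll' (ZZ (-1) _ Zv).
have [lB' _] := ll'; have [_ ->] := dual_ball_linear lB'.
have [_ ->] := dual_ball_linear (xsB n).
by rewrite scaleN1r normrN; lra.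
Qed.

(** Near-maximizers [l] at [z + v] and [l'] at [z - v] are also near-maximizers at [z]. The second
    difference is at most [l v - l' v + 2 * r], which [near_max_close] controls. *)
Lemma snorm_smooth z (e : R) : 0 < e -> exists2 d : R, 0 < d &
  forall v, Z v -> `|v| < d ->
    snorm k (z + v) + snorm k (z - v) - 2 * snorm k z <= e * `|v|.
Proof.
move=> e0; have [t t0 ht] := near_max_close z (divr_gt0 e0 (ltr0n R 2)).
exists (t / 4); first by rewrite divr_gt0.
move=> v Zv vt; have [->|v0] := eqVneq v 0.
  by rewrite addr0 subr0 normr0 mulr0; lra.
(* The first bound, with [|v| < t / 4], keeps both functionals in [near_max z t]; the second makes
   [2 * r] at most half of the allowed error. *)
pose r := Num.min (t / 2) (e * `|v| / 4).
have r0 : 0 < r by rewrite lt_min !divr_gt0 //= mulr_gt0 // normr_gt0.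
have r1 : r <= t / 2 by rewrite ge_min lexx.
have r2 : r <= e * `|v| / 4 by rewrite ge_min lexx orbT.
have [l lB hl] := snorm_approx (z + v) r0.
have [l' lB' hl'] := snorm_approx (z - v) r0.
move: hl hl'; rewrite (is_linearB _ _ (dual_ball_linear lB')).
have [-> _] := dual_ball_linear lB => hl hl'.
have := dual_ball_norm v lB; have := dual_ball_norm v lB'.
have := snorm_lip z (z + v); have := snorm_lip z (z - v).
rewrite opprB addrCA subrr addr0 opprD addrA subrr add0r normrN.
rewrite !ler_norml => h1 h2 /andP[h3 h4] /andP[h5 h6].
have ll : near_max z t l by split => //; lra.
have ll' : near_max z t l' by split => //; lra.
have := ht _ _ ll ll' _ Zv.
have := snorm_ge z lB; have := snorm_ge z lB'; lra.
Qed.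

End fixed_parameter.

End smooth_norm.

(** * Directional derivatives and the variational principle *)

Section directional_derivative.
Variables (R : realType) (X : lmodType R) (G : X -> R).
Hypothesis Gconvex : forall (t : R) x y, 0 <= t -> t <= 1 ->
  G (t *: x + (1 - t) *: y) <= t * G x + (1 - t) * G y.
Variable a : X.
Implicit Types (u v : X) (s t : R).

(** For convex [G] the difference quotient is nondecreasing in [t], so this infimum is the one-sided
    directional derivative. *)
Definition dirder v := inf [set t^-1 * (G (a + t *: v) - G a) | t in [set t : R | 0 < t]].

(** [a] is a convex combination of [a + t *: v] and [a - v], which bounds the quotients from below
    independently of [t]. *)
Lemma dirder_lb v : lbound
  [set t^-1 * (G (a + t *: v) - G a) | t in [set t : R | 0 < t]] (- (G (a - v) - G a)).
Proof.
move=> _ [t t0 <-]; rewrite /= in t0; have t1 : 0 < 1 + t by lra.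
have := @Gconvex (1 + t)^-1 (a + t *: v) (a - v).
have -> : 1 - (1 + t)^-1 = t / (1 + t).
  by field; rewrite lt0r_neq0.
have -> : (1 + t)^-1 *: (a + t *: v) + (t / (1 + t)) *: (a - v) = a.
  rewrite mulrC -scalerA -scalerDr scalerBr addrACA [t *: v - _]subrr addr0.
  by rewrite -{1}[a]scale1r -scalerDl scalerA mulVf ?scale1r // gt_eqF.
have i0 : 0 <= (1 + t)^-1 by rewrite invr_ge0 ltW.
have i1 : (1 + t)^-1 <= 1 by rewrite invf_le1 //; lra.
move=> /(_ i0 i1)/(ler_wpM2l (ltW t1)).
have -> : (1 + t) * ((1 + t)^-1 * G (a + t *: v) + t / (1 + t) * G (a - v)) =
    G (a + t *: v) + t * G (a - v) by field; rewrite lt0r_neq0.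
by rewrite ler_pdivlMl //; lra.
Qed.

Lemma dirder_ne v :
  [set t^-1 * (G (a + t *: v) - G a) | t in [set t : R | 0 < t]] !=set0.
Proof. by exists (1^-1 * (G (a + 1 *: v) - G a)), 1 => /=. Qed.

Lemma dirder_le v t : 0 < t -> t * dirder v <= G (a + t *: v) - G a.
Proof.
move=> t0; rewrite -ler_pdivlMl //.
by apply: inf_le_mem (@dirder_lb v) _; exists t.
Qed.

Lemma dirder_le1 v : dirder v <= G (a + v) - G a.
Proof. by have := dirder_le v ltr01; rewrite mul1r scale1r. Qed.

Lemma dirder_approx v (e : R) : 0 < e -> exists2 d : R, 0 < d &
  forall t, 0 < t -> t < d -> G (a + t *: v) - G a <= t * (dirder v + e).
Proof.
move=> e0; have [||_ [s s0 <-] hs] := @inf_lt R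
    [set t^-1 * (G (a + t *: v) - G a) | t in [set t : R | 0 < t]] (dirder v + e).
- exact: dirder_ne.
- by rewrite /dirder ltrDl.
exists s => // t t0 ts; rewrite /= in s0; have := @Gconvex (t / s) (a + s *: v) a.
have -> : (t / s) *: (a + s *: v) + (1 - t / s) *: a = a + t *: v.
  rewrite scalerDr addrAC -scalerDl addrCA subrr addr0 scale1r scalerA.
  by rewrite divfK ?gt_eqF.
have r0 : 0 <= t / s by rewrite divr_ge0 // ltW.
have r1 : t / s <= 1 by rewrite ler_pdivrMr // mul1r ltW.
move=> /(_ r0 r1) h.
have := ler_wpM2l (ltW t0) (ltW hs); rewrite mulrA; lra.
Qed.

Lemma dirder_sublinear : sublinear dirder.
Proof.
have Z s v : 0 < s -> dirder (s *: v) <= s * dirder v.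
  move=> s0; rewrite -ler_pdivrMl //; apply: lb_le_inf; first exact: dirder_ne.
  move=> _ [t t0 <-]; rewrite /= in t0; have ts : 0 < t / s by rewrite divr_gt0.
  have := dirder_le (s *: v) ts; rewrite scalerA divfK ?gt_eqF // => h.
  by rewrite ler_pdivlMl // mulrA.
apply: sublinearZ => //.
- move=> u v; apply/ler_addgt0Pr => e e0.
  have e20 : 0 < e / 2 by rewrite divr_gt0.
  have [d d0 hd] := dirder_approx u e20; have [d' d'0 hd'] := dirder_approx v e20.
  pose t := Num.min d d' / 2; have m0 : 0 < Num.min d d' by rewrite lt_min d0.
  have t0 : 0 < t by rewrite divr_gt0.
  have td : t < d.
    rewrite /t; apply: (@lt_le_trans _ _ (Num.min d d')); first by lra.
    by rewrite ge_min lexx.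
  have td' : t < d'.
    rewrite /t; apply: (@lt_le_trans _ _ (Num.min d d')); first by lra.
    by rewrite ge_min lexx orbT.
  have t20 : 0 < t / 2 by rewrite divr_gt0.
  have := dirder_le (u + v) t20.
  (* The midpoint of [a + t *: u] and [a + t *: v] is [a + (t / 2) *: (u + v)]. *)
  have := @Gconvex 2^-1 (a + t *: u) (a + t *: v).
  have -> : 1 - 2^-1 = 2^-1 :> R by lra.
  have -> : 2^-1 *: (a + t *: u) + 2^-1 *: (a + t *: v) = a + (t / 2) *: (u + v).
    rewrite !scalerDr addrACA !scalerA [2^-1 * t]mulrC -scalerDl.
    by rewrite (_ : 2^-1 + 2^-1 = 1) ?scale1r //; lra.
  have h2 : 0 <= 2^-1 :> R by lra.
  have h21 : 2^-1 <= 1 :> R by lra.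
  move=> /(_ h2 h21); have := hd t t0 td; have := hd' t t0 td'.
  move=> h3 h4 h5 h6; rewrite -(ler_pM2l t20); lra.
- apply/eqP; rewrite eq_le; apply/andP; split.
    by have := dirder_le1 0; rewrite addr0 subrr.
  apply: lb_le_inf; first exact: dirder_ne.
  by move=> _ [t t0 <-]; rewrite scaler0 addr0 subrr mulr0.
Qed.

End directional_derivative.

Section variational.
Variables (R : realType) (X : completeNormedModType R).

Lemma geometric_small (c e : R) : 0 < e -> exists n, c * 2^-1 ^+ n < e.
Proof.
move=> e0; have : (fun n => c * 2^-1 ^+ n : R^o) @ \oo --> (0 : R).
  by rewrite -[0](mulr0 c); apply: cvgMr; apply: cvg_expr; rewrite ger0_norm; lra.
move=> /cvgrPdist_lt/(_ e e0)[N _ /(_ N (leqnn N))] /=.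
rewrite sub0r normrN => hN; exists N; exact: le_lt_trans (ler_norm _) hN.
Qed.

Lemma le_geometric (a b c : R) : (forall n, a <= b + c * 2^-1 ^+ n) -> a <= b.
Proof.
move=> h; apply/ler_addgt0Pr => e e0; have [n hn] := geometric_small c e0.
by apply: le_trans (h n) _; rewrite lerD2l ltW.
Qed.

Lemma geometric_limit (V : completeNormedModType R) (u : nat -> V) (c : R) :
  (forall n, `|u n.+1 - u n| <= c * weight R n) ->
  exists l, forall n, `|l - u n| <= c * 2^-1 ^+ n.
Proof.
move=> hu; have c0 : 0 <= c.
  have := le_trans (normr_ge0 _) (hu 0%N).
  by rewrite pmulr_lge0 // weight_gt0.
have p0 n : 0 <= 2^-1 ^+ n :> R by rewrite exprn_ge0.
have step n j : `|u (n + j)%N - u n| <= c * (2^-1 ^+ n - 2^-1 ^+ (n + j)).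
  elim: j => [|j ih]; first by rewrite addn0 !subrr normr0 mulr0.
  rewrite addnS; have := ler_normD (u (n + j).+1 - u (n + j)%N) (u (n + j)%N - u n).
  rewrite addrA subrK; have := hu (n + j)%N; rewrite /weight exprS; lra.
have bound n j : `|u (n + j)%N - u n| <= c * 2^-1 ^+ n.
  apply: le_trans (step n j) _; apply: ler_wpM2l => //.
  by rewrite gerBl.
have cu : cvgn u.
  apply/cauchy_cvgP/cauchyP => e e0.
  have [n hn] := geometric_small c e0; exists (u n); exists n => // m /= /subnKC <-.
  by rewrite -ball_normE /= distrC; apply: le_lt_trans (bound _ _) hn.
exists (limn u) => n; apply/ler_addgt0Pr => e e0.
have /cvgrPdist_lt/(_ e e0)[N _ hN] := cu.
have := hN (n + N)%N (leq_addl _ _) => /= h.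
have := ler_normD (limn u - u (n + N)%N) (u (n + N)%N - u n).
by rewrite addrA subrK; have := bound n N; lra.
Qed.

(* For convex [F] this second-difference condition is Frechet differentiability
   at [y] in the directions of [Z]. *)
Definition smooth_along (Z : set X) (F : X -> R) (y : X) :=
  forall e : R, 0 < e -> exists2 d : R, 0 < d &
    forall v, Z v -> `|v| < d -> F (y + v) + F (y - v) - 2 * F y <= e * `|v|.

(** The properties of [snorm Z xs] on which the variational argument relies. *)
Record smooth_norm_approx (Z : set X) (F : R -> X -> R) : Prop := {
  sna_lip : forall (k : R) z z', 0 < k -> F k z - F k z' <= `|z - z'|;
  sna_le : forall (k : R) z, 0 < k -> F k z <= `|z|;
  sna_ge : forall (k : R) z, 0 < k -> `|z| - 4 * k <= F k z;
  sna_convex : forall (k t : R) z z', 0 < k -> 0 <= t -> t <= 1 ->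
    F k (t *: z + (1 - t) *: z') <= t * F k z + (1 - t) * F k z';
  sna_smooth : forall (k : R) z, 0 < k -> smooth_along Z (F k) z }.

(* Borwein-Preiss: successive near-minimizers [a n] are penalized by smooth
   approximations of the distance to [a n]. *)
Lemma smooth_variational (Z E : set X) (T : R -> X -> R) (x : X) (e r : R) :
  smooth_norm_approx Z T -> closed E -> E !=set0 ->
  0 < e -> e <= 1 -> 0 < r -> r <= 1 ->
  exists a G, [/\ E a, forall y, E y -> `|x - a| <= `|x - y| + r,
    forall (t : R) y z, 0 <= t -> t <= 1 ->
      G (t *: y + (1 - t) *: z) <= t * G y + (1 - t) * G z &
    [/\ forall y z, G y - G z <= (1 + e) * `|y - z|, smooth_along Z G a,
      forall y, E y -> G a <= G y & G x - G a <= - (1 - e) * `|x - a| + r]].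
Proof.
move=> [Tlip Tle Tge Tcvx Tsm] Ecl [y0 Ey0] e0 e1 r0 r1.
pose w : nat -> R := weight R.
have w0 n : 0 < w n by exact: weight_gt0.
have w1 n : w n <= 1 by apply: exprn_ile1; lra.
have wS n : w n.+1 = w n / 2 by rewrite /w /weight exprS mulrC.
(* The smoothing error [4 * k n] is [r * w n / 4], and near-minimality costs
   [2 * eta n = e * w n * (r * w n / 4)]. Together they give the step length [r / 2 * w n] in
   [adist]. *)
pose k n := r * w n / 16; pose eta n := e * w n * (r * w n) / 8.
have k0 n : 0 < k n by rewrite divr_gt0 // mulr_gt0.
have eta0 n : 0 < eta n by rewrite divr_gt0 // !mulr_gt0.
pose pick n (F : X -> R) : X :=
  get [set y | E y /\ forall y', E y' -> F y <= F y' + eta n].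
pose fix F n : X -> R := if n is n'.+1
  then fun y => F n' y + e * w n' * T (k n') (y - pick n' (F n'))
  else fun y => T (r / 16) (y - x).
pose a n := pick n (F n).
have FS n y : F n.+1 y = F n y + e * w n * T (k n) (y - a n) by [].
have F0 y : F 0%N y = T (r / 16) (y - x) by [].
have r16 : 0 < r / 16 by rewrite divr_gt0.
have ew n : 0 < e * w n by rewrite mulr_gt0.
have Flb n y : - 1 - (1 - 2^-1 ^+ n) <= F n y.
  elim: n => [|n ih].
    rewrite F0 expr0; have := Tge _ (y - x) r16.
    by have := normr_ge0 (y - x); lra.
  rewrite FS; have h : - (4 * k n) <= T (k n) (y - a n).
    by have := Tge _ (y - a n) (k0 n); have := normr_ge0 (y - a n); lra.
  have h4 : 4 * k n <= 1.
    by rewrite /k; have : r * w n <= 1 by [apply: mulr_ile1 => //; exact: ltW]; lra.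
  have : - w n <= e * w n * T (k n) (y - a n).
    have : e * w n * (- 1) <= e * w n * T (k n) (y - a n).
      by apply: ler_wpM2l; [exact: ltW|lra].
    by have : e * w n <= 1 * w n by [rewrite ler_pM2r]; lra.
  rewrite /w /weight exprS in ih *; lra.
have aP n : E (a n) /\ forall y', E y' -> F n (a n) <= F n y' + eta n.
  apply: (@getPex _
    [set y | E y /\ forall y', E y' -> F n y <= F n y' + eta n]).
  pose V := [set F n y | y in E].
  have V0 : V !=set0 by exists (F n y0), y0.
  have [||_ [y Ey <-] hy] := @inf_lt R V (inf V + eta n) => //.
    by rewrite ltrDl.
  exists y; split => // y' Ey'; apply: (le_trans (ltW hy)); rewrite lerD2r.
  apply: (@inf_le_mem _ _ (-2)); last by exists y'.
  move=> _ [z Ez <-]; apply: le_trans (Flb n z).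
  by have : 0 <= 2^-1 ^+ n :> R by [rewrite exprn_ge0]; lra.
have Ea n : E (a n) by case: (aP n).
have amin n y : E y -> F n (a n) <= F n y + eta n by case: (aP n) => _; apply.
have Flip n y z : F n y - F n z <= (1 + e * (1 - 2^-1 ^+ n)) * `|y - z|.
  elim: n => [|n ih].
    rewrite !F0 expr0 subrr mulr0 addr0 mul1r.
    by have := Tlip _ (y - x) (z - x) r16; rewrite opprB addrA subrK.
  rewrite !FS; have := Tlip _ (y - a n) (z - a n) (k0 n).
  rewrite opprB addrA subrK => /(ler_wpM2l (ltW (ew n))).
  rewrite /w /weight exprS in ih *; lra.
have step n y z : `|(F n.+1 y - F n.+1 z) - (F n y - F n z)| <= e * `|y - z| * w n.
  rewrite !FS [X in `|X|](_ : _ =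
    e * w n * (T (k n) (y - a n) - T (k n) (z - a n))); last by lra.
  rewrite normrM gtr0_norm // [leRHS]mulrAC ler_pM2l //.
  have := Tlip _ (y - a n) (z - a n) (k0 n); have := Tlip _ (z - a n) (y - a n) (k0 n).
  rewrite !opprB !addrA !subrK [`|z - y|]distrC ler_norml => ? ?.
  by apply/andP; split; lra.
(* [a n.+1] competes with [a n] for [F n.+1], and conversely for [F n]; the two near-minimality
   inequalities leave only the penalty term. *)
have adist n : `|a n.+1 - a n| <= r / 2 * w n.
  have h1 := amin n.+1 _ (Ea n); have h2 := amin n _ (Ea n.+1).
  rewrite !FS subrr in h1.
  have T0 : T (k n) 0 <= 0 by have := Tle _ 0 (k0 n); rewrite normr0.
  have h3 : e * w n * T (k n) 0 <= 0 by rewrite pmulr_rle0.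
  have h4 := Tge _ (a n.+1 - a n) (k0 n).
  have h5 : e * w n * T (k n) (a n.+1 - a n) <= e * w n * (r * w n / 4).
    have : eta n.+1 <= eta n.
      rewrite /eta wS; have := w0 n; have : 0 < e * w n * (r * w n) by rewrite !mulr_gt0.
      lra.
    rewrite {2}/eta; move: h1 h2 h3; rewrite /eta; lra.
  rewrite ler_pM2l // in h5; rewrite /k in h4; lra.
have [al hal] := geometric_limit adist.
have Eal : E al.
  apply: Ecl => B /nbhs_normP[d /= d0 dB].
  have [n hn] := geometric_small (r / 2) d0; exists (a n); split => //.
  by apply: dB; exact: le_lt_trans (hal n) hn.
(* [step] controls differences of values only, so the limit is taken after normalizing each [F n] to
   vanish at 0. *)
have [|G hG] := @choice X R (fun y g => forall n,
    `|g - (F n y - F n 0)| <= e * `|y| * 2^-1 ^+ n).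
  move=> y; apply: (@geometric_limit R^o (fun n => F n y - F n 0)) => n.
  by have := step n y 0; rewrite subr0.
have GF n y z : `|(G y - G z) - (F n y - F n z)| <= e * `|y - z| * 2^-1 ^+ n.
  have [l hl] := @geometric_limit R^o (fun n => F n y - F n z) _ (fun n => step n y z).
  suff -> : G y - G z = l by exact: hl.
  have close (c : R) : (forall m,
      `|c| <= (e * `|y - z| + e * `|y| + e * `|z|) * 2^-1 ^+ m) -> c = 0.
    move=> h; apply/eqP; rewrite -normr_le0.
    by apply: le_geometric => m; rewrite add0r; exact: h.
  apply/eqP; rewrite -subr_eq0; apply/eqP/close => m.
  have := hl m; have := hG y m; have := hG z m.
  rewrite !ler_norml => /andP[? ?] /andP[? ?] /andP[? ?].
  by apply/andP; split; lra.
have GL n y z : G y - G z <= F n y - F n z + e * `|y - z| * 2^-1 ^+ n.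
  by have := GF n y z; rewrite ler_norml => /andP[_]; lra.
have Fcvx n (t : R) y z : 0 <= t -> t <= 1 ->
    F n (t *: y + (1 - t) *: z) <= t * F n y + (1 - t) * F n z.
  have aff b : t *: y + (1 - t) *: z - b = t *: (y - b) + (1 - t) *: (z - b).
    rewrite !scalerBr addrACA -opprD -[in RHS]scalerDl.
    by rewrite (_ : t + (1 - t) = 1) ?scale1r //; lra.
  move=> t0 t1; elim: n => [|n ih]; first by rewrite !F0 aff; exact: Tcvx.
  rewrite !FS aff; have := Tcvx _ _ (y - a n) (z - a n) (k0 n) t0 t1.
  by rewrite -(ler_pM2l (ew n)); lra.
have Fsm n y : smooth_along Z (F n) y.
  elim: n => [|n ih] c c0.
    have [d d0 hd] := Tsm _ (y - x) r16 c c0; exists d => // v Zv vd.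
    by rewrite !F0 ![y + _ - x]addrAC; exact: hd.
  have c20 : 0 < c / 2 by rewrite divr_gt0.
  have [d d0 hd] := Tsm _ (y - a n) (k0 n) _ c20; have [d' d'0 hd'] := ih _ c20.
  exists (Num.min d d'); first by rewrite lt_min d0.
  move=> v Zv; rewrite lt_min => /andP[vd vd'].
  rewrite !FS ![y + _ - a n]addrAC; have := hd _ Zv vd; have := hd' _ Zv vd'.
  have ew1 : e * w n <= 1 by apply: mulr_ile1 => //; exact: ltW.
  move=> h h'; have := ler_wpM2l (ltW (ew n)) h'.
  have : e * w n * (c / 2 * `|v|) <= c / 2 * `|v|.
    by rewrite ler_piMl // mulr_ge0 // ltW.
  by lra.
exists al, G; split => //.
(* The errors are [r / 4] from smoothing, at most [r / 8] from [eta 0], and [r / 2] from moving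
   [a 0] to the limit. *)
- move=> y Ey; have := hal 0%N; rewrite expr0 mulr1 => h1.
  have := amin 0%N _ Ey; rewrite !F0 => h2.
  have := Tge _ (a 0%N - x) r16; have := Tle _ (y - x) r16.
  have := ler_normD (x - a 0%N) (a 0%N - al); rewrite addrA subrK.
  rewrite [`|a 0%N - x|]distrC [`|y - x|]distrC [`|a 0%N - al|]distrC.
  have h3 : eta 0%N <= r / 8.
    have ewrw : e * w 0%N * (r * w 0%N) <= r.
      rewrite mulrCA; apply: ler_piMr; first exact: ltW.
      by do 2?apply: mulr_ile1 => //; exact: ltW.
    by rewrite /eta; lra.
  lra.
- move=> t y z t0 t1; apply: (@le_geometric _ _ (t * (e * `|t *: y + (1 - t) *: z - y|) +
    (1 - t) * (e * `|t *: y + (1 - t) *: z - z|))) => n.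
  have := Fcvx n t y z t0 t1.
  have := GL n (t *: y + (1 - t) *: z) y; have := GL n (t *: y + (1 - t) *: z) z.
  set p := t *: y + (1 - t) *: z; have t10 : 0 <= 1 - t by lra.
  move=> /(ler_wpM2l t10) h1 /(ler_wpM2l t0) h2; lra.
split.
- move=> y z; have := GL 0%N y z; have := Flip 0%N y z.
  by rewrite !expr0 subrr mulr0 addr0; lra.
- move=> c c0; have c20 : 0 < c / 2 by rewrite divr_gt0.
  have [n hn] := geometric_small (2 * e) c20.
  have [d d0 hd] := Fsm n al _ c20; exists d => // v Zv vd.
  have := hd v Zv vd; have := GL n (al + v) al; have := GL n (al - v) al.
  rewrite ![al + _ - al]addrAC subrr !add0r normrN.
  have := ler_wpM2r (normr_ge0 v) (ltW hn); lra.
(* Passing from [G] to [F n], from the limit to [a n], and using near-minimality each cost a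
   multiple of [2^-1 ^+ n]. *)
- move=> y Ey; apply: (@le_geometric _ _ (e * `|al - y| + e + r)) => n.
  have := GL n al y; have := Flip n al (a n); have := amin n _ Ey; have := hal n.
  have p0 : 0 <= 2^-1 ^+ n :> R by rewrite exprn_ge0.
  have p1 : 2^-1 ^+ n <= 1 :> R by apply: exprn_ile1; lra.
  have : eta n <= e * 2^-1 ^+ n.
    rewrite /eta; have : r * w n <= 1 by apply: mulr_ile1 => //; exact: ltW.
    have : e * w n = e * 2^-1 ^+ n / 2 by rewrite /w /weight exprS; lra.
    move=> -> h; have : 0 <= e * 2^-1 ^+ n by rewrite mulr_ge0 // ltW.
    by nra.
  have : (1 + e * (1 - 2^-1 ^+ n)) * `|al - a n| <= 2 * `|al - a n|.
    by apply: ler_wpM2r => //; nra.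
  lra.
- have := GL 0%N x al; rewrite !F0 subrr expr0.
  have := Tle _ 0 r16; have := Tge _ (al - x) r16.
  rewrite normr0 [`|al - x|]distrC; lra.
Qed.

End variational.

(** * Separable reduction and approximate projections *)

Definition normal_at (R : realType) (X : normedModType R) (A : set X) (a : X)
    (l : X -> R) :=
  forall c : R, 0 < c -> exists2 d : R, 0 < d &
    forall y, A y -> `|y - a| < d -> l (y - a) <= c * `|y - a|.

Section normal_in_subspace.
Variables (R : realType) (X : completeNormedModType R).

(** The normal is [- L] for a linear [L] below the directional derivative of the perturbed function
    [G] at its minimizer [a]. For [y = a + v], smoothness along [Z] bounds [- L v] by [G a - G y]
    plus a small multiple of [|v|], and [G a <= G y]. *)
Lemma normal_in_subspace (Z A : set X) (T : R -> X -> R) (x : X) (e r : R) :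
  smooth_norm_approx Z T -> linear_subspace Z -> closed Z -> closed A ->
  A `&` Z !=set0 -> 0 < e -> e <= 1 -> 0 < r -> r <= 1 ->
  exists a l, [/\ (A `&` Z) a, forall y, (A `&` Z) y -> `|x - a| <= `|x - y| + r,
    is_linear l, forall v, l v <= (1 + e) * `|v| &
    normal_at (A `&` Z) a l /\ (1 - e) * `|x - a| - r <= l (x - a)].
Proof.
move=> sT [Z0 ZD ZZ] Zcl Acl AZ0 e0 e1 r0 r1.
have [a [G [AZa aP Gc [GL Gs Gmin Gx]]]] :=
  smooth_variational x sT (closedI Acl Zcl) AZ0 e0 e1 r0 r1.
have [L LL LG] := linear_below (dirder_sublinear Gc a).
have {}LG v : L v <= G (a + v) - G a by exact: le_trans (LG v) (dirder_le1 Gc a v).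
have lN v : L (- v) = - L v by exact: is_linearN.
exists a, (fun v => L (- v)); split => //.
- split=> [u v|t v]; first by rewrite opprD LL.1.
  by rewrite -scalerN LL.2.
- move=> v; apply: le_trans (LG (- v)) _; apply: le_trans (GL _ _) _.
  by rewrite addrAC subrr add0r normrN.
split; last by have := LG (x - a); rewrite lN [a + (x - a)]addrC subrK; lra.
move=> c c0; have [d d0 hd] := Gs c c0; exists d => // y [Ay Zy] yd.
have Zv : Z (y - a).
  by apply: ZD => //; rewrite -scaleN1r; apply: ZZ; case: AZa.
have := hd _ Zv yd; have := Gmin y (conj Ay Zy); have := LG (- (y - a)).
by rewrite [a + (y - a)]addrC subrK; lra.
Qed.

End normal_in_subspace.

(** [D] enumerates the values of all finite terms built from the operations [f c]; such terms are
    trees over a countable type and can be coded by numbers. *)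
Lemma countable_closure (C : countType) (T : Type) (t0 : T) (f : C -> seq T -> T) :
  exists D : nat -> T, forall c (s : seq nat), exists m, D m = f c [seq D i | i <- s].
Proof.
pose ev := fix ev (t : GenTree.tree C) : T := match t with
  | GenTree.Leaf _ => t0
  | GenTree.Node n ts => if unpickle n is Some c then f c (map ev ts) else t0
  end.
pose tr i : GenTree.tree C := odflt (GenTree.Node 0 [::]) (unpickle i).
exists (fun i => ev (tr i)) => c s.
exists (pickle (GenTree.Node (pickle c) (map tr s))).
by rewrite {1}/tr pickleK /= pickleK -map_comp.
Qed.

Section separable_reduction.
Variables (R : realType) (X : completeNormedModType R).
Variables (A : set X) (x : X) (rho c : R).
Implicit Types (a y : X) (s : seq (R * X * nat)) (kap : nat -> nat).

Let shift s a : X := \sum_(p <- s) p.1.1 *: (p.1.2 - a).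
Let cost s a : R := \sum_(p <- s) p.1.1 * (`|p.1.2 - a| / p.2.+1%:R).

(* A finite family [s] of weighted points is a certificate that no functional
   [l] with [l v <= c * `|v|], [rho * `|x - a| <= l (x - a)] satisfies
   [l (y - a) <= `|y - a| / n.+1] at all points [y] of [s]. *)
Let violates s a := c * `|x - a - shift s a| + cost s a < rho * `|x - a|.

(** A point of [s] is a triple of weight, location and tolerance index [n]; [kap] is a modulus of
    normality, giving the radius within which the tolerance [n.+1%:R^-1] is required. *)
Let inside kap s a := forall p, p \in s ->
  [/\ 0 <= p.1.1, A p.1.2 & `|p.1.2 - a| < (kap p.2).+1%:R^-1].

Lemma near_all (T : eqType) (s : seq T) (P : T -> X -> Prop) a :
  (forall p, p \in s -> \forall b \near a, P p b) ->
  \forall b \near a, forall p, p \in s -> P p b.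
Proof.
elim: s => [_|p s ih h]; first by near=> b.
have h1 : \forall b \near a, P p b by apply: h; rewrite mem_head.
have h2 : \forall b \near a, forall p, p \in s -> P p b.
  by apply: ih => q qs; apply: h; rewrite in_cons qs orbT.
near=> b => q; rewrite in_cons => /orP[/eqP ->|]; first by near: b.
by move: q; near: b.
Unshelve. all: by end_near. Qed.

(** Every condition that involves [a] is a strict inequality between continuous functions. *)
Lemma violation_open kap s a : inside kap s a -> violates s a ->
  \forall b \near a, inside kap s b /\ violates s b.
Proof.
move=> ins vio.
have shift_cont : continuous (shift s).
  rewrite /shift; elim: s {ins vio} => [|p s ih] b.
    by under eq_fun do rewrite big_nil; exact: cvg_cst.
  under eq_fun do rewrite big_cons.
  apply: cvgD; last exact: ih.
  by apply: cvgZr; apply: cvgB; [exact: cvg_cst|exact: cvg_id].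
have cost_cont : continuous (cost s).
  rewrite /cost; elim: s {ins vio shift_cont} => [|p s ih] b.
    by under eq_fun do rewrite big_nil; exact: cvg_cst.
  under eq_fun do rewrite big_cons.
  apply: cvgD; last exact: ih.
  apply: cvgMr; apply: cvgMl; apply: cvg_norm.
  by apply: cvgB; [exact: cvg_cst|exact: cvg_id].
have h1 : \forall b \near a, forall p, p \in s -> `|p.1.2 - b| < (kap p.2).+1%:R^-1.
  apply: near_all => p ps; have [_ _ lt] := ins p ps.
  have cv : `|p.1.2 - b| @[b --> a] --> `|p.1.2 - a|.
    by apply: cvg_norm; apply: cvgB; [exact: cvg_cst|exact: cvg_id].
  exact: cvgr_lt cv _ lt.
have h2 : \forall b \near a,
    c * `|x - b - shift s b| + cost s b - rho * `|x - b| < 0.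
  have cv : c * `|x - b - shift s b| + cost s b - rho * `|x - b| @[b --> a] -->
      c * `|x - a - shift s a| + cost s a - rho * `|x - a|.
    have xb : x - b @[b --> a] --> x - a.
      by apply: cvgB; [exact: cvg_cst|exact: cvg_id].
    apply: cvgB; last by apply: cvgMr; apply: cvg_norm.
    apply: cvgD; last exact: cost_cont.
    apply: cvgMr; apply: cvg_norm; apply: cvgB => //; exact: shift_cont.
  by apply: cvgr_lt cv _ _; rewrite subr_lt0.
near=> b; split; last by rewrite /violates -subr_lt0; near: b.
have hb : forall p, p \in s -> `|p.1.2 - b| < (kap p.2).+1%:R^-1 by near: b.
by move=> p ps; have [? ? _] := ins p ps; split => //; exact: hb.
Unshelve. all: by end_near. Qed.

(** [D] is closed under choosing, for each ball with center [D i] and radius [j.+1%:R^-1], a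
    certificate valid on the whole ball, if there is one. By openness a violation at [a] is valid on
    such a ball around [a], so the chosen one, with points in the range of [D], is a violation at
    [a] as well. *)
Lemma separable_reduction (y0 : X) : exists D : nat -> X,
  [/\ exists n, D n = x, exists n, D n = y0,
    forall i j, exists n, D n = D i + D j,
    forall (q : rat) i, exists n, D n = ratr q *: D i &
    forall kap a, (forall e : R, 0 < e -> exists n, `|a - D n| < e) ->
      (forall s, inside kap s a -> (forall p, p \in s -> exists n, D n = p.1.2) ->
         ~ violates s a) ->
      forall s, inside kap s a -> ~ violates s a].
Proof.
(* There are uncountably many [kap], but a certificate reads only finitely many values; recording
   these in the list [ks] keeps the operations countable in number. *)
pose robust (ks : seq nat) (j : nat) a s :=
  forall b, `|a - b| < j.+1%:R^-1 -> inside (nth 0%N ks) s b /\ violates s b /\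
    forall p, p \in s -> (p.2 < size ks)%N.
pose W ks j a := xget [::] (robust ks j a).
pose f (k : nat * rat * seq nat * nat * nat) (u : seq X) : X :=
  match k with
  | (0%N, _, _, _, _) => x
  | (1%N, _, _, _, _) => y0
  | (2%N, _, _, _, _) => nth 0 u 0 + nth 0 u 1
  | (3%N, q, _, _, _) => ratr q *: nth 0 u 0
  | (_, _, ks, j, m) => (nth (0, 0, 0%N) (W ks j (nth 0 u 0)) m).1.2
  end.
have [D DP] := countable_closure x f.
exists D; split.
- have [m mE] := DP (0%N, 0%Q, [::] : seq nat, 0%N, 0%N) [::].
  by exists m; rewrite mE.
- have [m mE] := DP (1%N, 0%Q, [::] : seq nat, 0%N, 0%N) [::].
  by exists m; rewrite mE.
- move=> i j.
  have [m mE] := DP (2%N, 0%Q, [::] : seq nat, 0%N, 0%N) [:: i; j].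
  by exists m; rewrite mE.
- move=> q i; have [m mE] := DP (3%N, q, [::] : seq nat, 0%N, 0%N) [:: i].
  by exists m; rewrite mE.
have WD ks j i p : p \in W ks j (D i) -> exists n, D n = p.1.2.
  move=> pW; pose m := index p (W ks j (D i)).
  have [n nE] := DP (4%N, 0%Q, ks, j, m) [:: i].
  by exists n; rewrite nE /= nth_index.
move=> kap a aD hD s sa vs.
have /nbhs_normP[d /= d0 hd] := violation_open sa vs.
pose N := \max_(p <- s) p.2.
pose ks := mkseq kap N.+1.
have sN p : p \in s -> (p.2 < N.+1)%N.
  by move=> ps; rewrite ltnS /N (big_rem p) //= leq_maxl.
have [j jd] : exists j, j.+1%:R^-1 < d / 2.
  have d20 : 0 < d / 2 by rewrite divr_gt0.
  by have [M _ /(_ _ (leqnn M))] := near_infty_natSinv_lt (PosNum d20); exists M.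
have j0 : 0 < j.+1%:R^-1 :> R by rewrite invr_gt0.
(* The ball of radius [j.+1%:R^-1] around [D i] contains [a] and lies in the ball of radius [d]
   around [a]. *)
have [i ai] := aD _ j0.
have rob : robust ks j (D i) (W ks j (D i)).
  apply: (@xgetPex _ [::] (robust ks j (D i))); exists s => b ib.
  have [|ib1 ib2] := hd b.
    have := ler_normD (a - D i) (D i - b); rewrite addrA subrK /= => h.
    apply: le_lt_trans h _; apply: lt_trans (ltrD ai ib) _.
    by rewrite [ltRHS]splitr ltrD.
  split; last by split => // p /sN; rewrite size_mkseq.
  by move=> p ps; have [? ? ?] := ib1 p ps; split => //; rewrite nth_mkseq // sN.
have [|ins [vio sz]] := rob a; first by rewrite distrC.
apply: (hD (W ks j (D i))) => //; last by move=> p; exact: WD.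
move=> p pW; have [h1 h2] := ins p pW.
by have := sz p pW; rewrite size_mkseq => pN; rewrite nth_mkseq.
Qed.

(** The cone [K] imposes [l (shift s a) <= cost s a]. Absence of violations says that [c * |v|],
    lowered by [K], is still at least [rho * |x - a|] at [x - a], where Hahn-Banach is applied;
    one-point families then give normality. *)
Lemma normal_of_no_violation kap a : 0 <= c ->
  (forall s, inside kap s a -> ~ violates s a) ->
  exists l, [/\ is_linear l, forall v, l v <= c * `|v|, rho * `|x - a| <= l (x - a) &
    normal_at A a l].
Proof.
move=> c0 nv.
pose K := [set k : X * R | exists2 s, inside kap s a & k = (- shift s a, - cost s a)].
have sn := norm_sublinear X c0.
have cost_ge0 s : inside kap s a -> 0 <= cost s a.
  move=> ins; rewrite /cost big_seq; apply: sumr_ge0 => p ps.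
  by have [t0 _ _] := ins p ps; rewrite mulr_ge0 // divr_ge0.
have lK : lowering (fun v : X => c * `|v|) K.
  split.
  - by exists [::] => //; rewrite /shift /cost !big_nil !oppr0.
  - move=> _ _ [s ss ->] [s' ss' ->] /=; exists (s ++ s').
      by move=> p; rewrite mem_cat => /orP[]; [exact: ss|exact: ss'].
    by rewrite /shift /cost !big_cat /= !opprD.
  - move=> t _ t0 [s ss ->] /=; exists [seq (t * p.1.1, p.1.2, p.2) | p <- s].
      move=> _ /mapP[p ps ->] /=; have [? ? ?] := ss p ps; split => //.
      by rewrite mulr_ge0 // ltW.
    rewrite /shift /cost !big_map /= scalerN mulrN scaler_sumr mulr_sumr.
    congr (- _, - _); apply: eq_bigr => p _; first by rewrite scalerA.
    by rewrite mulrA.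
  - move=> _ [s ss ->] /=; apply: (@le_trans _ _ 0); last by rewrite mulr_ge0.
    by rewrite oppr_le0; exact: cost_ge0.
have [l [ll lq lx]] := hahn_banach_point (x - a) (lower_sublinear sn lK).
exists l; split => //.
- by move=> v; apply: le_trans (lq v) (lower_leq v sn lK).
- rewrite lx; apply: lower_ge; first by case: lK.
  move=> _ [s ss ->] /=; rewrite opprK leNgt; apply/negP; exact: nv.
move=> e e0; have [n ne] : exists n, n.+1%:R^-1 < e :> R.
  by have [M _ /(_ _ (leqnn M))] := near_infty_natSinv_lt (PosNum e0); exists M.
exists (kap n).+1%:R^-1; first by rewrite invr_gt0.
move=> y Ay ya; apply: le_trans (lq _) _.
have /(lowerN sn lK)/= : K (- shift [:: (1, y, n)] a, - cost [:: (1, y, n)] a).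
  exists [:: (1, y, n)] => // p; rewrite inE => /eqP -> /=; split => //.
rewrite /shift /cost !big_seq1 /= !opprK scale1r mul1r => h.
by apply: (le_trans h); rewrite mulrC ler_wpM2r // ltW.
Qed.

End separable_reduction.

Section approximate_projection.
Variables (R : realType) (X : completeNormedModType R).
Hypothesis asplundX : asplund X.

Lemma asplund_smooth_norm (Z : set X) (D : nat -> X) : linear_subspace Z ->
  (forall z, Z z -> forall e : R, 0 < e -> exists n, `|z - D n| < e) ->
  exists T, smooth_norm_approx Z T.
Proof.
move=> sZ DZ; have [xs [xsB xsP]] := dual_ball_separable asplundX sZ DZ.
exists (snorm Z xs); split.
- by move=> k z z' k0; exact: snorm_lip.
- by move=> k z k0; exact: snorm_le_norm.
- by move=> k z k0; exact: norm_le_snorm.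
- by move=> k t z z' k0; exact: snorm_convex.
- by move=> k z k0 e e0; exact: snorm_smooth.
Qed.

Lemma approximate_projection (A : set X) (x y0 : X) (b : R) :
  closed A -> A y0 -> ~ A x -> 0 < b -> b < 1 ->
  exists a l, [/\ A a, dual_ball l, normal_at A a l,
    b * `|x - a| <= l (x - a) & b * `|x - a| <= `|x - y0|].
Proof.
move=> Acl Ay0 nAx b0 b1.
have [d d0 hd] : exists2 d : R, 0 < d & forall y, A y -> d <= `|x - y|.
  have : nbhs x (~` A) by apply: open_nbhs_nbhs; split => //; exact: closed_openC.
  move=> /nbhs_normP[d /= d0 hd]; exists d => // y Ay.
  by rewrite leNgt; apply/negP => /hd.
(* With this [e] one has [b * (1 + e) <= 1 - 2 * e], so the constants survive the final division by
   [1 + e]. *)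
pose e := (1 - b) / 4; have e0 : 0 < e by rewrite /e; lra.
have e1 : e <= 1 by rewrite /e; lra.
(* Points of [A] are at distance at least [d] from [x], so the additive error [r] is absorbed into a
   factor [e]. *)
pose r := Num.min 1 (e * d).
have r0 : 0 < r by rewrite lt_min ltr01 mulr_gt0.
have r1 : r <= 1 by rewrite ge_min lexx.
have rd : r <= e * d by rewrite ge_min lexx orbT.
have [D [[nx Dx] [ny Dy] DD Dq DR]] :=
  separable_reduction A x (1 - 2 * e) (1 + e) y0.
pose Z := closure (range D).
have ZP z : Z z <-> forall c : R, 0 < c -> exists n, `|z - D n| < c.
  split=> [Zz c c0|h B /nbhs_normP[c /= c0 hc]].
    have [|_ [[n _ <-] hn]] := Zz [set y | `|z - y| < c]; last by exists n.
    by apply/nbhs_normP; exists c.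
  by have [n hn] := h c c0; exists (D n); split; [exists n|exact: hc].
have sZ : linear_subspace Z.
  split.
  - apply/ZP => c c0; have [n Dn] := Dq 0%Q 0%N; exists n.
    by rewrite Dn rmorph0 scale0r subrr normr0.
  - move=> u v /ZP Zu /ZP Zv; apply/ZP => c c0.
    have c20 : 0 < c / 2 by rewrite divr_gt0.
    have [i ui] := Zu _ c20; have [j vj] := Zv _ c20; have [n Dn] := DD i j.
    exists n; rewrite Dn opprD addrACA; apply: le_lt_trans (ler_normD _ _) _; lra.
  - move=> t v /ZP Zv; apply/ZP => c c0.
    pose m := `|v| + 1; have m0 : 0 < m by rewrite ltr_wpDl.
    have c2m : 0 < Num.min 1 (c / 2 / m) by rewrite lt_min ltr01 !divr_gt0.
    (* [t *: v] is approximated by [ratr q *: D i]; the bound 1 on [ratr q - t] gives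
       [|ratr q| <= |t| + 1] before [i] is chosen. *)
    have [|q] := @rat_in_itvoo R t (t + Num.min 1 (c / 2 / m)); first by lra.
    rewrite in_itv /= => /andP[q1 q2].
    have qt : ratr q - t < Num.min 1 (c / 2 / m) by lra.
    have h1 : ratr q - t < 1.
      by apply: lt_le_trans qt _; rewrite ge_min lexx.
    have h2 : ratr q - t < c / 2 / m.
      by apply: lt_le_trans qt _; rewrite ge_min lexx orbT.
    pose t1 := `|t| + 1; have t10 : 0 < t1 by rewrite ltr_wpDl.
    have c2t : 0 < c / 2 / t1 by rewrite !divr_gt0.
    have [i vi] := Zv _ c2t; have [n Dn] := Dq q i; exists n; rewrite Dn.
    have -> : t *: v - ratr q *: D i = (t - ratr q) *: v + ratr q *: (v - D i).
      by rewrite scalerBl scalerBr addrA subrK.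
    apply: le_lt_trans (ler_normD _ _) _; rewrite 2!normrZ.
    have h3 : `|t - ratr q| * `|v| <= c / 2.
      apply: (@le_trans _ _ (c / 2 / m * m)); last by rewrite divfK // gt_eqF.
      apply: ler_pM => //; last by rewrite /m lerDl.
      by rewrite distrC gtr0_norm ?subr_gt0 // ltW.
    have h4 : `|ratr q : R| * `|v - D i| < c / 2.
      apply: (@le_lt_trans _ _ (t1 * `|v - D i|)).
        apply: ler_wpM2r => //; have := ler_normD t (ratr q - t).
        rewrite addrC subrK [`|_ - t|]gtr0_norm ?subr_gt0 // /t1; lra.
      by rewrite mulrC -ltr_pdivlMr.
    by rewrite [ltRHS]splitr; exact: ler_ltD.
have [T sT] := asplund_smooth_norm sZ (fun z => (ZP z).1).
have Zcl : closed Z by exact: closed_closure.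
have ZD n : Z (D n) by apply: subset_closure; exists n.
have AZ0 : A `&` Z !=set0 by exists y0; split => //; rewrite -Dy.
have [a [l [[Aa Za] ay ll lc [ln lx]]]] :=
  normal_in_subspace x sT sZ Zcl Acl AZ0 e0 e1 r0 r1.
(* [kap] records the radii of normality of [l] within [Z], for the tolerances [n.+1%:R^-1]. *)
have [n|kap kapP] := @choice nat nat (fun n k => forall y, (A `&` Z) y ->
    `|y - a| < k.+1%:R^-1 -> l (y - a) <= `|y - a| / n.+1%:R).
  have n0 : 0 < n.+1%:R^-1 :> R by rewrite invr_gt0.
  have [d' d'0 hd'] := ln _ n0.
  have [M _ /(_ _ (leqnn M)) hM] := near_infty_natSinv_lt (PosNum d'0).
  exists M => y AZy yM; rewrite mulrC; apply: hd' => //; exact: lt_trans yM hM.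
have xad : d <= `|x - a| by exact: hd.
have lxa : (1 - 2 * e) * `|x - a| <= l (x - a).
  have : e * d <= e * `|x - a| by rewrite ler_pM2l.
  lra.
have c0 : 0 <= 1 + e by lra.
have [|l' [ll' lc' lx' ln']] :=
    @normal_of_no_violation _ _ A x (1 - 2 * e) (1 + e) kap a c0.
  (* For families with points in [Z] the functional [l] itself excludes a violation. *)
  apply: (DR kap a ((ZP a).1 Za)) => s ins sD; apply/negP; rewrite -leNgt.
  apply: le_trans lxa _.
  have -> : l (x - a) = l (x - a - \sum_(p <- s) p.1.1 *: (p.1.2 - a)) +
      \sum_(p <- s) p.1.1 * l (p.1.2 - a).
    rewrite (is_linearB (x - a) _ ll).
    have -> : l (\sum_(p <- s) p.1.1 *: (p.1.2 - a)) =
        \sum_(p <- s) p.1.1 * l (p.1.2 - a).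
      rewrite (big_morph l ll.1 (is_linear0 ll)).
      by apply: eq_bigr => p _; rewrite ll.2.
    by rewrite subrK.
  apply: lerD; first exact: lc.
  rewrite !big_seq; apply: ler_sum => p ps; have [t0 Ap pa] := ins p ps.
  apply: ler_wpM2l => //; apply: kapP => //.
  by split => //; have [m <-] := sD p ps.
have e10 : 0 < 1 + e by lra.
exists a, (fun v => l' v / (1 + e)); split => //.
- split; first split.
  + by move=> u v; rewrite ll'.1 mulrDl.
  + by move=> t v; rewrite ll'.2 mulrA.
  + by move=> v; rewrite ler_pdivrMr // mulrC.
- move=> h h0; have he0 : 0 < h * (1 + e) by rewrite mulr_gt0.
  have [d' d'0 hd'] := ln' _ he0; exists d' => // y Ay yd.
  by rewrite ler_pdivrMr // mulrAC; exact: hd'.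
- rewrite ler_pdivlMr //; apply: le_trans lx'; rewrite mulrAC.
  apply: ler_wpM2r => //; rewrite /e; nra.
- have := ay y0 (conj Ay0 _); rewrite -Dy => /(_ (ZD _)); rewrite Dy => h.
  have hd0 := hd _ Ay0.
  have : e * d <= e * `|x - y0| by rewrite ler_pM2l.
  move=> h'; have h2 : `|x - a| <= (1 + e) * `|x - y0| by lra.
  apply: le_trans (ler_wpM2l (ltW b0) h2) _; rewrite mulrA ler_piMl //.
  rewrite /e; nra.
Qed.

End approximate_projection.

(** * Frechet normals and subgradients in epsilon-delta form *)

Lemma limf_esup_le0 (R : realType) (T : pnbhsType) (f : T -> R)
  (F : set_system T) : Filter F ->
  (limf_esup (fun y => (f y)%:E) F <= 0)%E <->
  forall c : R, 0 < c -> \forall y \near F, f y <= c.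
Proof.
move=> FF; rewrite limf_esupE; split=> [h c c0|h].
  have /ereal_inf_lt[_ [V FV <-] lt] :
      (ereal_inf [set ereal_sup ((fun y => (f y)%:E) @` V) | V in F] < c%:E)%E.
    by apply: le_lt_trans h _; rewrite lte_fin.
  apply: filterS FV => y Vy; rewrite -lee_fin; apply: le_trans (ltW lt).
  by apply: ereal_sup_ubound; exists y.
apply/lee_addgt0Pr => c c0; rewrite add0e.
apply: (@le_trans _ _ (ereal_sup ((fun y => (f y)%:E) @` [set y | f y <= c]))).
  by apply: ereal_inf_lbound; exists [set y | f y <= c] => //; exact: h.
by apply: ge_ereal_sup => _ [y /= yc <-]; rewrite lee_fin.
Qed.

Section functionals.
Variables (R : realType) (X : normedModType R).

Lemma is_linear_pack (l : X -> R) : is_linear l ->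
  exists L : {linear X -> R^o}, forall v, L v = l v.
Proof.
move=> [lD lZ].
have ll : linear (l : X -> R^o) by move=> t u v; rewrite lD lZ.
pose L := GRing.isLinear.Build R X R^o *:%R (l : X -> R^o) ll.
pose LL : {linear X -> R^o} := HB.pack (l : X -> R^o) L.
by exists LL.
Qed.

Lemma linear_is_linear (L : {linear X -> R^o}) : is_linear L.
Proof. by split=> [u v|t v]; rewrite ?linearD ?linearZ. Qed.

(** Continuity of [L] bounds the set whose [sup] is [opnorm L]; then homogeneity passes from the
    unit ball to all vectors. *)
Lemma dual_unit_ballP (L : {linear X -> R^o}) :
  dual_unit_ball L <-> dual_ball (L : X -> R).
Proof.
have ll := linear_is_linear L.
split=> [[Lc L1]|LB].
  split => // v; have [k k0 Lk] := linear_lipschitz Lc.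
  have ub u : `|u| <= 1 -> `|L u| <= 1.
    move=> u1; apply: le_trans L1; apply: (@le_sup_ub _ _ k); last by exists u.
    by move=> _ [w /= w1 <-]; apply: le_trans (Lk w) _; rewrite ler_piMr // ltW.
  have [->|v0] := eqVneq v 0; first by rewrite (is_linear0 ll) normr0.
  have nv : 0 < `|v| by rewrite normr_gt0.
  have := ub (`|v|^-1 *: v); rewrite normrZ normfV normr_id mulVf ?gt_eqF //.
  rewrite ll.2 => /(_ (lexx _)); rewrite normrM normfV normr_id.
  rewrite mulrC ler_pdivrMr // mul1r; exact: le_trans (ler_norm _).
split.
  apply: (@lipschitz_continuous _ _ 1) => u v; rewrite mul1r -(is_linearB _ _ ll).
  by apply: le_trans (ler_norm _) (dual_ball_norm _ LB).
apply: ge_sup; first by exists `|L 0|, 0 => //=; rewrite normr0.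
by move=> _ [u /= u1 <-]; apply: le_trans (dual_ball_norm u LB) u1.
Qed.

Lemma near_punctured (A : set X) (a : X) (P : X -> Prop) :
  (\forall y \near within A a^', P y) <->
  exists2 d : R, 0 < d & forall y, A y -> `|y - a| < d -> y != a -> P y.
Proof.
split=> [h|[d d0 hd]].
  have : \forall y \near a, y != a -> A y -> P y by exact: h.
  move=> /nbhs_normP[d /= d0 hd]; exists d => // y Ay ya ne.
  by apply: hd => //=; rewrite distrC.
suff : \forall y \near a, y != a -> A y -> P y by exact.
apply/nbhs_normP; exists d => // y /= ya ne Ay; apply: hd => //.
by rewrite distrC.
Qed.

Lemma frechet_normal_coneP (A : set X) (a : X) (L : {linear X -> R^o}) :
  frechet_normal_cone A a L <-> dual L /\ normal_at A a L.
Proof.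
have L0 : L 0 = 0 by rewrite linear0.
split=> -[Lc h]; split => //.
  move/limf_esup_le0: h => h c c0; have /near_punctured[d d0 hd] := h c c0.
  exists d => // y Ay ya; have [->|ne] := eqVneq y a.
    by rewrite subrr L0 normr0 mulr0.
  by rewrite -ler_pdivrMr ?normr_gt0 ?subr_eq0 //; exact: hd.
apply/limf_esup_le0 => c c0; have [d d0 hd] := h c c0.
apply/near_punctured; exists d => // y Ay ya ne.
by rewrite ler_pdivrMr ?normr_gt0 ?subr_eq0 //; exact: hd.
Qed.

Definition subgradient_at (phi : X -> R) (x : X) (l : X -> R) :=
  forall c : R, 0 < c -> exists2 d : R, 0 < d &
    forall v, `|v| < d -> l v <= phi (x + v) - phi x + c * `|v|.

Lemma frechet_subdiffP (phi : X -> R) (x : X) (L : {linear X -> R^o}) :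
  frechet_subdiff phi x L <-> dual L /\ subgradient_at phi x L.
Proof.
have L0 : L 0 = 0 by rewrite linear0.
pose q y := - ((phi y - phi x - L (y - x)) / `|y - x|).
have -> : frechet_subdiff phi x L <->
    dual L /\ forall c : R, 0 < c -> \forall y \near x^', q y <= c.
  rewrite /frechet_subdiff /= /limf_einf oppe_ge0.
  by split=> -[? /limf_esup_le0].
have E : x^' = within setT x^'.
  apply/funext => P; apply/propext; split=> h.
    by have : \forall y \near x^', setT y -> P y by apply: filterS h.
  have {}h : \forall y \near x^', setT y -> P y by exact: h.
  by apply: filterS h => y; apply.
rewrite E; split=> -[Lc h]; split => //.
  move=> c c0; have /near_punctured[d d0 hd] := h c c0.
  exists d => // v vd; have [->|ne] := eqVneq v 0.
    by rewrite addr0 subrr L0 normr0 mulr0 addr0.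
  have nv : 0 < `|v| by rewrite normr_gt0.
  have := hd (x + v) I; rewrite /q addrAC subrr add0r => /(_ vd).
  rewrite -subr_eq0 addrAC subrr add0r => /(_ ne).
  by rewrite -mulNr ler_pdivrMr //; lra.
move=> c c0; have [d d0 hd] := h c c0.
apply/near_punctured; exists d => // y _ yd ne; have := hd _ yd.
rewrite [x + _]addrC subrK /q -mulNr ler_pdivrMr ?normr_gt0 ?subr_eq0 //; lra.
Qed.

End functionals.

(** * Local Lipschitz continuity and strict differentiability *)

Section convex_lipschitz.
Variables (R : realType) (Y : normedModType R) (g : Y -> R).
Hypothesis gcont : continuous g.
Hypothesis gconvex : forall (t : R) x y, 0 <= t -> t <= 1 ->
  g (t *: x + (1 - t) *: y) <= t * g x + (1 - t) * g y.

Lemma convex_locally_lipschitz (y : Y) : exists L r : R, [/\ 0 < L, 0 < r &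
  forall u v, `|u - y| < r -> `|v - y| < r -> g u - g v <= L * `|u - v|].
Proof.
have /cvgrPdist_le/(_ 1 ltr01)/nbhs_normP[r /= r0 hr] := @gcont y.
exists (4 / r), (r / 2); split; rewrite ?divr_gt0 // => u v uy vy.
have [->|uv] := eqVneq u v; first by rewrite !subrr normr0 mulr0.
set n := `|u - v|; have n0 : 0 < n by rewrite normr_gt0 subr_eq0.
pose s := n / (r / 2 + n); have rn : 0 < r / 2 + n by rewrite addr_gt0 // divr_gt0.
(* The segment from [v] to [u] is prolonged by [r / 2] beyond [u], staying where [g] differs from
   [g y] by at most 1; convexity then bounds the slope between [v] and [u]. *)
pose w := u + (r / 2 / n) *: (u - v).
have s0 : 0 <= s by rewrite divr_ge0 // ltW.
have s1 : s <= 1 by rewrite ler_pdivrMr // mul1r; lra.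
have uE : u = s *: w + (1 - s) *: v.
  rewrite /w scalerDr scalerA (_ : s * (r / 2 / n) = 1 - s); last first.
    by rewrite /s; field; rewrite !gt_eqF //=; lra.
  rewrite scalerBr addrA subrK -scalerDl.
  by rewrite (_ : s + (1 - s) = 1) ?scale1r //; lra.
have := gconvex w v s0 s1; rewrite -uE => h.
have hw : g w <= g y + 1.
  have : `|g y - g w| <= 1.
    apply: hr; rewrite /= distrC /w addrAC; apply: le_lt_trans (ler_normD _ _) _.
    rewrite normrZ gtr0_norm ?divr_gt0 // -/n divfK ?gt_eqF //; lra.
  by rewrite ler_norml => /andP[]; lra.
have hv : g y - 1 <= g v.
  have : `|g y - g v| <= 1 by apply: hr; rewrite /= distrC; lra.
  by rewrite ler_norml => /andP[]; lra.
have : g u - g v <= s * 2.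
  have : s * (g w - g v) <= s * 2 by apply: ler_wpM2l => //; lra.
  lra.
move=> /le_trans; apply; rewrite /s mulrAC ler_pdivrMr //.
have -> : 4 / r * n * (r / 2 + n) = n * (2 + 4 / r * n) by field; rewrite gt_eqF.
by rewrite ler_pM2l // lerDl mulr_ge0 ?divr_ge0 // ltW.
Qed.

End convex_lipschitz.

(** A functional [U] that norms the error vector reduces the estimate to the scalar mean value
    theorem along the segment. The derivatives at the intermediate point and at [a] are both within
    [e / 2] of the derivative at [x]. *)
Lemma C1_strictly_differentiable (R : realType) (X Y : normedModType R)
  (f : X -> Y) (x : X) (e : R) : C1 f -> 0 < e ->
  exists2 d : R, 0 < d & forall a b, `|a - x| < d -> `|b - x| < d ->
    `|f b - f a - 'd f a (b - a)| <= e * `|b - a|.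
Proof.
move=> [fd fc] e0; have e20 : 0 < e / 2 by rewrite divr_gt0.
have /cvgrPdist_lt/(_ _ e20)/nbhs_normP[d /= d0 hd] := fc x.
have bound z v : `|z - x| < d -> `|'d f z v - 'd f x v| <= e / 2 * `|v|.
  move=> zx; have op : `|opnorm (fun u => 'd f z u - 'd f x u)| < e / 2.
    by have := hd z; rewrite /= sub0r normrN distrC; exact.
  have lip y : exists2 k : R, 0 < k & forall u, `|'d f y u| <= k * `|u|.
    by apply: linear_lipschitz; have /diff_locallyP[] := fd y.
  have [k k0 hk] := lip z; have [k' k'0 hk'] := lip x.
  have ub u : `|u| <= 1 -> `|'d f z u - 'd f x u| <= e / 2.
    move=> u1; apply: le_trans (ltW op); apply: le_trans (ler_norm _).
    apply: (@le_sup_ub _ _ (k + k')); last by exists u.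
    move=> _ [w /= w1 <-]; apply: le_trans (ler_normB _ _) _; apply: lerD.
      by apply: le_trans (hk w) _; rewrite ler_piMr // ltW.
    by apply: le_trans (hk' w) _; rewrite ler_piMr // ltW.
  have [->|v0] := eqVneq v 0.
    by rewrite (linear0 ('d f z)) (linear0 ('d f x)) subrr !normr0 mulr0.
  have nv : 0 < `|v| by rewrite normr_gt0.
  have := ub (`|v|^-1 *: v); rewrite normrZ normfV normr_id mulVf ?gt_eqF //.
  rewrite (linearZZ ('d f z)) (linearZZ ('d f x)) -scalerBr normrZ normfV.
  rewrite normr_id => /(_ (lexx _)).
  by rewrite mulrC ler_pdivrMr.
exists d => // a b ad bd; set w := b - a.
have [u uB <-] := norming_functional (f b - f a - 'd f a w).
have [U UE] := is_linear_pack (dual_ball_linear uB).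
have UB : dual_ball (U : Y -> R).
  by split=> [|v]; [exact: linear_is_linear|rewrite UE; exact: uB.2].
have [Uc _] := (dual_unit_ballP U).2 UB.
pose line (t : R) : X := a + t *: w.
have dline t : is_diff t line (fun s => s *: w).
  have -> : line = cst a + *:%R^~ w by [].
  have := is_diffD (is_diff_cst a t) (is_diff_scalel t w).
  by rewrite add0r.
pose h : R -> R := U \o (f \o line).
have dh (t : R) : is_derive t 1 h (U ('d f (line t) w)).
  have d0' : differentiable line t by exact: ex_diff.
  have d1 : differentiable (f \o line) t.
    exact: differentiable_comp.
  have d2 : differentiable (U : Y -> R^o) (f (line t)) by exact: linear_differentiable.
  have d3 : differentiable (h : R^o -> R^o) t by exact: differentiable_comp.
  apply: DeriveDef; first exact: diff_derivable.
  rewrite deriveE // diff_comp // diff_lin //= diff_comp //=.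
  have -> : 'd line t = *:%R^~ w :> (R -> X) by exact: diff_val.
  by rewrite scale1r.
have hc : continuous h.
  move=> t; apply: differentiable_continuous.
  by apply: (@derivable1_diffP _ _ h t).1; exact: ex_derive.
have [t] := @MVT R h (fun t => U ('d f (line t) w)) 0 1 ltr01 (fun t _ => dh t)
  (continuous_subspaceT hc).
rewrite in_itv /= => /andP[t0 t1].
rewrite subr0 mulr1 /h /= /line scale1r scale0r addr0 => mv.
have lt : `|line t - x| < d.
  have -> : line t - x = (1 - t) *: (a - x) + t *: (b - x).
    rewrite scalerBl scale1r -[RHS]addrA [X in _ = _ + X]addrC -scalerBr.
    by rewrite opprB addrA subrK /line addrAC.
  apply: le_lt_trans (ler_normD _ _) _.
  rewrite !normrZ !gtr0_norm ?subr_gt0 //.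
  have h1 : (1 - t) * `|a - x| < (1 - t) * d by rewrite ltr_pM2l // subr_gt0.
  have h2 : t * `|b - x| < t * d by rewrite ltr_pM2l.
  lra.
have ba : a + w = b by rewrite /w addrC subrK.
rewrite ba in mv.
have UL := linear_is_linear U.
rewrite -UE (is_linearB _ _ UL) (is_linearB _ _ UL) mv -(is_linearB _ _ UL).
apply: le_trans (UB.2 _) _.
have -> : 'd f (line t) w - 'd f a w =
    ('d f (line t) w - 'd f x w) - ('d f a w - 'd f x w).
  by rewrite opprB addrA subrK.
apply: le_trans (ler_normB _ _) _.
have := bound _ w lt; have := bound _ w ad; lra.
Qed.

(** * Multipliers and convex-composite functions *)

Section sublinear_decomposition.
Variables (R : realType) (X : lmodType R).
Implicit Types (p q l w : X -> R).

(** Lowering [p1] by the constraints [l - p2] forces [l v - p2 v <= l1 v], so that the rest [l - l1]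
    is below [p2]. *)
Lemma sublinear_sandwich p1 p2 l : sublinear p1 -> sublinear p2 -> is_linear l ->
  (forall v, l v <= p1 v + p2 v) ->
  exists l1 l2, [/\ is_linear l1, is_linear l2, forall v, l1 v <= p1 v,
    forall v, l2 v <= p2 v & forall v, l v = l1 v + l2 v].
Proof.
move=> s1 s2 ll lp; pose K := [set k : X * R | k.2 <= l k.1 - p2 k.1].
have lK : lowering p1 K.
  split; rewrite /K /=.
  - by rewrite (is_linear0 ll) (sublinear0 s2) subrr.
  - move=> [u c] [v d] /= h1 h2; rewrite ll.1; have := s2.1 u v; lra.
  - move=> t [u c] /= t0 h; rewrite ll.2 (s2.2 _ _ (ltW t0)) -mulrBr.
    by rewrite ler_pM2l.
  - by move=> [u c] /= h; have := lp u; lra.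
have [l1 ll1 h1] := linear_below (lower_sublinear s1 lK).
have l12 v : l v - l1 v <= p2 v.
  have := h1 (- v); have /(lowerN s1 lK)/= : K (v, l v - p2 v) by rewrite /K /=.
  by rewrite (is_linearN _ ll1); lra.
exists l1, (fun v => l v - l1 v); split => //.
- split=> [u v|t v]; first by rewrite ll.1 ll1.1; lra.
  by rewrite ll.2 ll1.2 mulrBr.
- by move=> v; apply: le_trans (h1 v) (lower_leq v s1 lK).
- by move=> v; rewrite addrC subrK.
Qed.

Lemma sublinear_sum (I : eqType) (s : seq I) (p : I -> X -> R) :
  (forall i, sublinear (p i)) -> sublinear (fun v => \sum_(i <- s) p i v).
Proof.
move=> sp; split=> [u v|t v t0].
  by rewrite -big_split /=; apply: ler_sum => i _; exact: (sp i).1.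
by rewrite mulr_sumr; apply: eq_bigr => i _; exact: (sp i).2.
Qed.

Lemma sublinear_sum_decomposition (I : eqType) (s : seq I) (p : I -> X -> R) l :
  uniq s -> (forall i, sublinear (p i)) -> is_linear l ->
  (forall v, l v <= \sum_(i <- s) p i v) ->
  exists w : I -> X -> R, (forall i, i \in s ->
    is_linear (w i) /\ forall v, w i v <= p i v) /\
    forall v, l v = \sum_(i <- s) w i v.
Proof.
move=> us sp; elim: s us l => [_ l ll lp|i s ih /= /andP[nis us] l ll lp].
  exists (fun _ _ => 0); split => // v; rewrite big_nil.
  have := lp v; have := lp (- v); rewrite !big_nil (is_linearN _ ll); lra.
have [l1 [l2 [ll1 ll2 h1 h2 lE]]] :
  exists l1 l2, [/\ is_linear l1, is_linear l2, forall v, l1 v <= p i v,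
    forall v, l2 v <= \sum_(j <- s) p j v & forall v, l v = l1 v + l2 v].
  apply: sublinear_sandwich => //; first exact: sublinear_sum.
  by move=> v; have := lp v; rewrite big_cons.
have [w [wP wE]] := ih us l2 ll2 h2.
exists (fun j => if j == i then l1 else w j); split=> [j|v].
  rewrite in_cons; case: eqVneq => [->|_] //=; exact: wP.
rewrite big_cons eqxx lE wE; congr (_ + _); apply: eq_big_seq => j js.
by case: eqVneq => // ji; rewrite -ji js in nis.
Qed.

Lemma sublinear_pos_part q (c : R) : sublinear q -> 0 <= c ->
  sublinear (fun v => c * Num.max (q v) 0).
Proof.
move=> sq c0; split=> [u v|t v t0].
  rewrite -mulrDr; apply: ler_wpM2l => //; rewrite ge_max; apply/andP; split.
    by apply: le_trans (sq.1 u v) _; apply: lerD; rewrite le_max lexx.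
  by rewrite addr_ge0 // le_max lexx orbT.
by rewrite (sq.2 _ _ t0) mulrCA; congr (_ * _); rewrite maxr_pMr // mulr0.
Qed.

(* The subdifferential at 0 of [c * max q 0] is the union of the [lam * dq]
   with [0 <= lam <= c], where [dq] is that of [q]. *)
Lemma pos_part_multiplier q w (c : R) : sublinear q -> is_linear w -> 0 <= c ->
  (forall v, w v <= c * Num.max (q v) 0) ->
  exists lam u, [/\ 0 <= lam <= c, is_linear u, forall v, u v <= q v &
    forall v, w v = lam * u v].
Proof.
move=> sq lw c0 wq.
(* [lam] is the least possible multiplier. Including 0 makes it nonnegative even if [q] is never
   positive. *)
pose E := [set r : R | r = 0 \/ exists2 v, 0 < q v & r = w v / q v].
have E0 : E !=set0 by exists 0; left.
have ub : ubound E c.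
  move=> _ [->|[v qv ->]] //; rewrite ler_pdivrMr //.
  by have := wq v; rewrite max_l // ltW.
pose lam := sup E; have lam0 : 0 <= lam by apply: le_sup_ub ub _; left.
have wlam v : w v <= lam * q v.
  have [qv|qv|qv] := ltgtP 0 (q v).
  - by rewrite -ler_pdivrMr //; apply: le_sup_ub ub _; right; exists v.
  - have : lam <= w v / q v.
      apply: ge_sup => // _ [->|[u qu ->]].
        rewrite -mulrNN -invrN divr_ge0 // oppr_ge0; last exact: ltW.
        by have := wq v; rewrite max_r ?mulr0 // ltW.
      rewrite ler_ndivlMr // mulrAC ler_pdivlMr //.
      (* As [q v < 0 < q u], both coefficients are positive. Hence [w] is at most 0 at this vector,
         which says [w u / q u <= w v / q v]. *)
      have qle : q ((- q v) *: u + q u *: v) <= 0.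
        apply: le_trans (sq.1 _ _) _; rewrite !sq.2 ?oppr_ge0 //; try exact: ltW.
        by rewrite mulNr mulrC addNr.
      have := wq ((- q v) *: u + q u *: v); rewrite max_r // mulr0.
      by rewrite lw.1 !lw.2; lra.
    by rewrite ler_ndivlMr.
  - by rewrite -qv mulr0; have := wq v; rewrite -qv max_l // mulr0.
have lamc : lam <= c by exact: ge_sup.
(* If [lam = 0], then [w] is below 0, hence zero, and any linear functional below [q] serves as
   [u]. *)
have [l0|ln] := eqVneq lam 0.
  have [u lu uq] := linear_below sq; exists 0, u; split; rewrite ?lexx // => v.
  have := wlam v; have := wlam (- v); rewrite l0 !mul0r (is_linearN _ lw); lra.
have lp : 0 < lam by rewrite lt_neqAle eq_sym ln.
exists lam, (fun v => w v / lam); split; rewrite ?lam0 //.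
- by split=> [u v|t v]; rewrite ?lw.1 ?lw.2 ?mulrDl ?mulrA.
- by move=> v; rewrite ler_pdivrMr // mulrC.
- by move=> v; rewrite mulrC divfK.
Qed.

End sublinear_decomposition.

Section convex_composite.
Variables (R : realType) (X Y : normedModType R) (f : X -> Y) (g : Y -> R).
Hypothesis C1f : C1 f.
Hypothesis gcont : continuous g.
Hypothesis gconvex : forall (t : R) x y, 0 <= t -> t <= 1 ->
  g (t *: x + (1 - t) *: y) <= t * g x + (1 - t) * g y.

Definition composite_dirder (x v : X) := dirder g (f x) ('d f x v).

Let fdiff x : differentiable f x. Proof. by case: C1f. Qed.

Lemma composite_dirder_sublinear x : sublinear (composite_dirder x).
Proof.
have sg := dirder_sublinear gconvex (f x); split=> [u v|t v t0].
  by rewrite /composite_dirder linearD; exact: sg.1.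
by rewrite /composite_dirder linearZZ; exact: sg.2.
Qed.

Lemma f_near x (e : R) : 0 < e -> exists2 d : R, 0 < d &
  forall y, `|y - x| < d -> `|f y - f x| < e.
Proof.
move=> e0; have /cvgrPdist_lt/(_ e e0)/nbhs_normP[d /= d0 hd] :=
  differentiable_continuous (fdiff x).
by exists d => // y yx; rewrite distrC; apply: hd; rewrite /= distrC.
Qed.

(* Uniform in the base point [a]; with [a = x] it also gives the Frechet
   estimates at [x]. *)
Lemma composite_linearization x : exists2 L : R, 0 < L & forall e : R, 0 < e ->
  exists2 d : R, 0 < d & forall a b, `|a - x| < d -> `|b - x| < d ->
    `|g (f b) - g (f a + 'd f a (b - a))| <= L * (e * `|b - a|).
Proof.
have [L [r [L0 r0 hL]]] := convex_locally_lipschitz gcont gconvex (f x).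
exists L => // e e0.
have [d1 d10 h1] := C1_strictly_differentiable x C1f e0.
have r20 : 0 < r / 2 by rewrite divr_gt0.
have [d2 d20 h2] := f_near x r20.
(* This makes [e * |b - a| < r / 2], so that the linearized point stays in the ball where [g] is
   Lipschitz. *)
pose d3 := r / (4 * e); have d30 : 0 < d3 by rewrite divr_gt0 // mulr_gt0.
exists (Num.min d1 (Num.min d2 d3)); first by rewrite !lt_min d10 d20.
move=> a b; rewrite !lt_min => /andP[a1 /andP[a2 a3]] /andP[b1 /andP[b2 b3]].
have rem := h1 a b a1 b1.
have ba : `|b - a| <= `|b - x| + `|a - x|.
  by have := ler_normB (b - x) (a - x); rewrite opprB addrA subrK.
have small : e * `|b - a| < r / 2.
  have : `|b - a| < d3 + d3 by lra.
  rewrite -(ltr_pM2l e0) => /lt_le_trans; apply.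
  by rewrite /d3 le_eqVlt; apply/orP; left; apply/eqP; field; rewrite gt_eqF.
have fb := h2 b b2.
have far : `|f a + 'd f a (b - a) - f x| < r.
  have -> : f a + 'd f a (b - a) - f x = (f b - f x) - (f b - f a - 'd f a (b - a)).
    rewrite opprB [RHS]addrCA opprB [X in _ = _ + X]addrC.
    by rewrite [X in _ = _ + X]addrA subrK [LHS]addrAC addrC.
  by apply: le_lt_trans (ler_normB _ _) _; lra.
have fbr : `|f b - f x| < r by lra.
have E : f b - (f a + 'd f a (b - a)) = f b - f a - 'd f a (b - a).
  by rewrite opprD addrA.
have := hL _ _ fbr far; have := hL _ _ far fbr.
rewrite [`|_ - f b|]distrC E => l1 l2.
have := ler_wpM2l (ltW L0) rem.
by rewrite ler_norml => ?; apply/andP; split; lra.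
Qed.

Lemma composite_dirder_ge x v (e : R) : 0 < e -> exists2 d : R, 0 < d &
  forall t, 0 < t -> t < d ->
    g (f (x + t *: v)) - g (f x) <= t * (composite_dirder x v + e).
Proof.
move=> e0; have [L L0 hL] := composite_linearization x.
have e20 : 0 < e / 2 by rewrite divr_gt0.
have n0 : 0 < `|v| + 1 by rewrite ltr_wpDl.
pose e' := e / 2 / L / (`|v| + 1); have e'0 : 0 < e' by rewrite !divr_gt0.
have [d d0 hd] := hL e' e'0.
have [d' d'0 hd'] := dirder_approx gconvex (f x) ('d f x v) e20.
exists (Num.min d' (d / (`|v| + 1))); first by rewrite lt_min d'0 divr_gt0.
move=> t t0; rewrite lt_min => /andP[td' ]; rewrite ltr_pdivlMr // => td.
have nt : `|t *: v| = t * `|v| by rewrite normrZ gtr0_norm.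
have xtx : `|x + t *: v - x| < d.
  by rewrite addrAC subrr add0r nt; apply: le_lt_trans td; rewrite ler_pM2l // lerDl.
have := hd x (x + t *: v); rewrite subrr normr0 => /(_ d0 xtx).
rewrite addrAC subrr add0r nt linearZZ => h1; have := hd' t t0 td'.
have : L * (e' * (t * `|v|)) <= t * (e / 2).
  have -> : L * (e' * (t * `|v|)) = t * (e / 2) * (`|v| / (`|v| + 1)).
    by rewrite /e'; field; rewrite !gt_eqF.
  by rewrite ler_piMr ?mulr_ge0 ?ltW // ltr_pdivrMr // mul1r; lra.
move: h1; rewrite ler_norml /composite_dirder => /andP[_]; lra.
Qed.

(** Together with [composite_subgradient], this identifies Frechet subgradients of [g \o f] with
    linear functionals below the sublinear [composite_dirder f g x]. *)
Lemma composite_subgradient_le x l : is_linear l ->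
  subgradient_at (g \o f) x l -> forall v, l v <= composite_dirder x v.
Proof.
move=> ll sub v; have [->|v0] := eqVneq v 0.
  by rewrite (is_linear0 ll) (sublinear0 (composite_dirder_sublinear x)).
have nv : 0 < `|v| by rewrite normr_gt0.
apply/ler_addgt0Pr => e e0; have e20 : 0 < e / 2 by rewrite divr_gt0.
have e2v : 0 < e / 2 / `|v| by rewrite divr_gt0.
have [d d0 hd] := sub _ e2v; have [d' d'0 hd'] := composite_dirder_ge x v e20.
pose m := Num.min d' (d / `|v|); have m0 : 0 < m by rewrite lt_min d'0 divr_gt0.
pose t := m / 2; have t0 : 0 < t by rewrite divr_gt0.
have tm : t < m by rewrite /t; lra.
move: (tm); rewrite /m lt_min => /andP[td']; rewrite ltr_pdivlMr // => td.
have nt : `|t *: v| = t * `|v| by rewrite normrZ gtr0_norm.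
have := hd (t *: v); rewrite nt => /(_ td); rewrite ll.2 /=.
have := hd' t t0 td'; rewrite mulrCA divfK ?gt_eqF // => h1 h2.
by rewrite -(ler_pM2l t0); lra.
Qed.

Lemma composite_subgradient x l : is_linear l ->
  (forall v, l v <= composite_dirder x v) -> subgradient_at (g \o f) x l.
Proof.
move=> ll lq e e0; have [L L0 hL] := composite_linearization x.
have eL : 0 < e / L by rewrite divr_gt0.
have [d d0 hd] := hL _ eL; exists d => // v vd.
have := hd x (x + v); rewrite subrr normr0 addrAC subrr add0r => /(_ d0 vd).
rewrite mulrA [L * _]mulrC divfK ?gt_eqF // ler_norml => /andP[h1 _].
have := dirder_le1 gconvex (f x) ('d f x v).
by have := lq v; rewrite /composite_dirder /=; lra.
Qed.

(** Approximate convexity of [g \o f] near [x]: the subgradient inequality holds up to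
    [e * |b - a|], uniformly in the base point [a]. *)
Lemma composite_dirder_uniform x (e : R) : 0 < e -> exists2 d : R, 0 < d &
  forall a b, `|a - x| < d -> `|b - x| < d ->
    composite_dirder a (b - a) <= g (f b) - g (f a) + e * `|b - a|.
Proof.
move=> e0; have [L L0 hL] := composite_linearization x.
have eL : 0 < e / L by rewrite divr_gt0.
have [d d0 hd] := hL _ eL; exists d => // a b ad bd.
have := hd a b ad bd.
rewrite mulrA [L * _]mulrC divfK ?gt_eqF // ler_norml => /andP[h1 _].
by have := dirder_le1 gconvex (f a) ('d f a (b - a)); rewrite /composite_dirder; lra.
Qed.

Lemma composite_dirder_bound x : exists2 k : R, 0 < k &
  forall v, composite_dirder x v <= k * `|v|.
Proof.
have [k k0 hk] : exists2 k : R, 0 < k & forall u, `|'d f x u| <= k * `|u|.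
  by apply: linear_lipschitz; have /diff_locallyP[] := fdiff x.
have [L [r [L0 r0 hL]]] := convex_locally_lipschitz gcont gconvex (f x).
exists (L * k); first exact: mulr_gt0.
move=> v; set w := 'd f x v; have n0 : 0 < `|w| + 1 by rewrite ltr_wpDl.
pose t := r / 2 / (`|w| + 1); have t0 : 0 < t by rewrite !divr_gt0.
have nt : `|t *: w| = t * `|w| by rewrite normrZ gtr0_norm.
have tw : t * `|w| < r.
  have : t * (`|w| + 1) = r / 2 by rewrite /t divfK // gt_eqF.
  by rewrite mulrDr mulr1; lra.
have := dirder_le gconvex (f x) w t0.
have := hL (f x + t *: w) (f x); rewrite subrr normr0 addrAC subrr add0r nt.
move=> /(_ tw r0) h1 h2.
have : composite_dirder x v <= L * `|w|.
  by rewrite /composite_dirder -/w -(ler_pM2l t0); lra.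
move=> /le_trans; apply; rewrite -mulrA ler_pM2l //; exact: hk.
Qed.

End convex_composite.

Lemma common_radius (R : realType) (I : finType) (P : I -> R -> Prop) :
  (forall i, exists2 d : R, 0 < d & forall t, 0 < t -> t < d -> P i t) ->
  exists2 d : R, 0 < d & forall t, 0 < t -> t < d -> forall i, P i t.
Proof.
move=> h; have [i|D DP] := @choice I R (fun i d => 0 < d /\
    forall t, 0 < t -> t < d -> P i t).
  by have [d d0 hd] := h i; exists d.
exists (\big[Num.min/1]_i D i).
  by apply: (big_ind (fun d => 0 < d)) => [//|d d' d0 d'0|i _];
    [rewrite lt_min d0|case: (DP i)].
move=> t t0 td i; have [_] := DP i; apply=> //.
by apply: lt_le_trans td _; exact: bigmin_le.
Qed.

Lemma dist_le (R : realType) (X : normedModType R) (A : set X) (x a : X) :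
  A a -> dist x A <= `|x - a|.
Proof.
move=> Aa; apply: (@inf_le_mem _ _ 0); last by exists a.
by move=> _ [y _ <-].
Qed.

(** * From the error bound to multipliers *)

Section necessity.
Variables (R : realType) (X Y : normedModType R) (f : X -> Y).
Hypothesis C1f : C1 f.
Variables (m : nat) (g : 'I_m -> Y -> R).
Hypothesis gcont : forall i, continuous (g i).
Hypothesis gconvex : forall i (t : R) x y, 0 <= t -> t <= 1 ->
  g i (t *: x + (1 - t) *: y) <= t * g i x + (1 - t) * g i y.

Let phi i := g i \o f.
Let A := sublevel_system phi.
Let r i x := composite_dirder f (g i) x.

Lemma phi_cont i : continuous (phi i).
Proof.
move=> x; apply: continuous_comp; last exact: gcont.
by apply: differentiable_continuous; case: C1f.
Qed.

(** An active constraint grows at most at the rate of its directional derivative; an inactive one is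
    negative at [x] and stays so nearby. *)
Lemma phi_pos_growth (i : 'I_m) x h (e : R) : A x -> 0 < e -> exists2 d : R, 0 < d &
  forall t, 0 < t -> t < d -> Num.max (phi i (x + t *: h)) 0 <=
    t * ((if active phi x i then Num.max (r i x h) 0 else 0) + e).
Proof.
move=> Ax e0; rewrite /active; case: eqVneq => [p0|pn0].
  have [d d0 hd] := composite_dirder_ge C1f (@gcont i) (@gconvex i) x h e0.
  exists d => // t t0 td; rewrite ge_max; apply/andP; split; last first.
    by rewrite mulr_ge0 ?addr_ge0 ?le_max ?lexx ?orbT // ltW.
  have := hd t t0 td; rewrite -[g i (f x)]/(phi i x) p0 subr0 => /le_trans; apply.
  by rewrite ler_pM2l // lerD2r le_max lexx.
have pneg : phi i x < 0 by rewrite lt_neqAle pn0; exact: Ax.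
have /cvgrPdist_lt/(_ (- phi i x))/= := @phi_cont i x.
rewrite oppr_gt0 => /(_ pneg)/nbhs_normP[d /= d0 hd].
have n0 : 0 < `|h| + 1 by rewrite ltr_wpDl.
exists (d / (`|h| + 1)); first by rewrite divr_gt0.
move=> t t0; rewrite ltr_pdivlMr // => td.
have : `|x - (x + t *: h)| < d.
  rewrite opprD addrA subrr add0r normrN normrZ gtr0_norm //.
  by apply: le_lt_trans td; rewrite ler_pM2l // lerDl.
move=> /hd; rewrite ltr_norml => /andP[h1 _].
by rewrite max_r ?add0r ?mulr_ge0 // ltW //; lra.
Qed.

(** The error bound puts a point [y] of [A] within about [t * S] of [x + t *: h]. Normality makes
    [l (y - x)] negligible, and the rest of [t * l h] is at most the distance from [y] to
    [x + t *: h]. *)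
Lemma normal_le_dirders (xbar x : X) (eta delta : R) (l : X -> R) :
  0 < eta ->
  (forall y, ball xbar delta y ->
    dist y A <= eta * \sum_(i < m) Num.max (phi i y) 0) ->
  A x -> ball xbar delta x -> dual_ball l -> normal_at A x l ->
  forall h, l h <= \sum_(i < m | active phi x i) eta * Num.max (r i x h) 0.
Proof.
move=> eta0 EB Ax Bx lB ln h.
set S := \sum_(i < m | _) _.
(* Three errors are collected: [eta * m%:R] from the growth of the constraints, 1 from the
   approximate nearest point, and [n = 2 * |h| + 1] from normality, since [|y - x| <= t * n]. *)
pose k := 2 * `|h| + 2 + eta * m%:R.
have k0 : 0 < k.
  have : 0 <= eta * m%:R by rewrite mulr_ge0 // ltW.
  by have := normr_ge0 h; rewrite /k; lra.
suff key e : 0 < e -> e <= 1 -> l h <= S + e * k.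
  apply/ler_addgt0Pr => e e0; pose e' := Num.min 1 (e / k).
  have e'0 : 0 < e' by rewrite lt_min ltr01 divr_gt0.
  have e'1 : e' <= 1 by rewrite ge_min lexx.
  have := key e' e'0 e'1; have : e' * k <= e.
    by rewrite -ler_pdivlMr // ge_min lexx orbT.
  by lra.
move=> e0 e1; have [d1 d10 hd1] := common_radius (fun i => phi_pos_growth i h Ax e0).
have [d2 d20 hd2] := ln e e0.
have [d3 d30 hd3] : exists2 d : R, 0 < d & forall y, `|y - x| < d -> ball xbar delta y.
  exists (delta - `|xbar - x|); first by move: Bx; rewrite -ball_normE subr_gt0.
  move=> y yx; rewrite -ball_normE /=.
  have := ler_normD (xbar - x) (x - y); rewrite addrA subrK [`|x - y|]distrC; lra.
pose n := 2 * `|h| + 1; have n0 : 0 < n by have := normr_ge0 h; rewrite /n; lra.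
pose d := Num.min d1 (Num.min (d2 / n) (d3 / n)).
have d0 : 0 < d by rewrite !lt_min d10 !divr_gt0.
pose t := d / 2; have t0 : 0 < t by rewrite divr_gt0.
have td : t < d by rewrite /t; lra.
move: (td); rewrite /d !lt_min => /andP[td1 /andP[]].
rewrite !ltr_pdivlMr // => td2 td3.
have nh : `|x + t *: h - x| = t * `|h| by rewrite addrAC subrr add0r normrZ gtr0_norm.
have hn : `|h| <= n by have := normr_ge0 h; rewrite /n; lra.
have Bxt : ball xbar delta (x + t *: h).
  by apply: hd3; rewrite nh; apply: le_lt_trans td3; rewrite ler_pM2l.
have dle : dist (x + t *: h) A <= t * (S + eta * m%:R * e).
  apply: le_trans (EB _ Bxt) _.
  have -> : t * (S + eta * m%:R * e) = eta * \sum_(i < m)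
      t * ((if active phi x i then Num.max (r i x h) 0 else 0) + e).
    rewrite -mulr_sumr big_split /= sumr_const card_ord -big_mkcond /=.
    rewrite /S -mulr_sumr -[e *+ m]mulr_natl; lra.
  rewrite ler_pM2l //; apply: ler_sum => i _; exact: hd1.
have te : 0 < e * t by rewrite mulr_gt0.
have [||_ [y Ay <-] yd] := @inf_lt R [set `|x + t *: h - y| | y in A]
    (dist (x + t *: h) A + e * t).
- by exists `|x + t *: h - x|, x.
- by rewrite /dist ltrDl.
have dxt : dist (x + t *: h) A <= t * `|h| by rewrite -nh; exact: dist_le.
have yx : `|y - x| <= t * n.
  have := ler_normB (x + t *: h - x) (x + t *: h - y).
  rewrite opprB addrC addrA subrK nh => le1; apply: (le_trans le1).
  have : e * t <= t by rewrite ler_piMl // ltW.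
  by rewrite /n; lra.
have yx2 : `|y - x| < d2 by apply: le_lt_trans yx td2.
have ll := dual_ball_linear lB.
have h1 := hd2 y Ay yx2.
have h2 : l (x + t *: h - y) <= `|x + t *: h - y|.
  by apply: le_trans (ler_norm _) (dual_ball_norm _ lB).
have h3 : t * l h = l (y - x) + l (x + t *: h - y).
  by rewrite -ll.1 -ll.2; congr l; rewrite addrC addrA subrK addrAC subrr add0r.
have h4 : e * `|y - x| <= e * (t * n) by rewrite ler_pM2l.
rewrite -(ler_pM2l t0) h3.
have -> : t * (S + e * k) = t * (S + eta * m%:R * e) + e * t + e * (t * n).
  by rewrite /k /n; lra.
lra.
Qed.

Lemma multipliers (xbar x : X) (eta delta : R) (L : {linear X -> R^o}) :
  0 < eta ->
  (forall y, ball xbar delta y ->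
    dist y A <= eta * \sum_(i < m) Num.max (phi i y) 0) ->
  A x -> ball xbar delta x -> frechet_normal_cone A x L -> dual_unit_ball L ->
  exists2 lambda : 'I_m -> R,
    forall i, active phi x i -> 0 <= lambda i <= eta &
    weighted_sum (active phi x) lambda (fun i => frechet_subdiff (phi i) x) L.
Proof.
move=> eta0 EB Ax Bx /frechet_normal_coneP[_ ln] /dual_unit_ballP LB.
have hle := normal_le_dirders eta0 EB Ax Bx LB ln.
pose s := [seq i <- index_enum 'I_m | active phi x i].
have sE (F : 'I_m -> R) : \sum_(i <- s) F i = \sum_(i < m | active phi x i) F i.
  by rewrite big_filter.
have sr i := composite_dirder_sublinear f (@gconvex i) x.
have [|i|||w [wP wE]] := @sublinear_sum_decomposition R X 'I_m s
    (fun i v => eta * Num.max (r i x v) 0) L.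
- by rewrite filter_uniq // index_enum_uniq.
- exact: sublinear_pos_part (sr i) (ltW eta0).
- exact: linear_is_linear.
- by move=> v; rewrite sE.
have [i|lu luP] := @choice 'I_m (R * {linear X -> R^o}) (fun i lu =>
    active phi x i -> [/\ 0 <= lu.1 <= eta, frechet_subdiff (phi i) x lu.2 &
      forall v, w i v = lu.1 * lu.2 v]).
  (* The pair chosen at an inactive index is arbitrary. *)
  have [ai|nai] := boolP (active phi x i); last by exists (0, L).
  have [|lw wle] := wP i; first by rewrite mem_filter ai mem_index_enum.
  have [lam [u [lam0 lu ur wu]]] := pos_part_multiplier (sr i) lw (ltW eta0) wle.
  have [U UE] := is_linear_pack lu; exists (lam, U) => _; split => //.
  - apply/frechet_subdiffP; split.
      have [k k0 hk] := composite_dirder_bound C1f (@gcont i) (@gconvex i) x.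
      apply: (@lipschitz_continuous _ _ k) => y z.
      by rewrite -(is_linearB _ _ (linear_is_linear U)) UE; apply: le_trans (ur _) (hk _).
    apply: (composite_subgradient C1f (@gcont i) (@gconvex i) (linear_is_linear U)).
    by move=> v; rewrite UE; exact: ur.
  - by move=> v /=; rewrite UE.
exists (fun i => (lu i).1); first by move=> i /luP[].
exists (fun i => (lu i).2); first by move=> i /luP[].
move=> v; rewrite wE sE; apply: eq_bigr => i /luP[_ _]; exact.
Qed.

End necessity.

(** * From multipliers to the error bound *)

Section sufficiency.
Variables (R : realType) (X Y : completeNormedModType R) (f : X -> Y).
Hypothesis asplundX : asplund X.
Hypothesis C1f : C1 f.
Variables (m : nat) (g : 'I_m -> Y -> R).
Hypothesis gcont : forall i, continuous (g i).
Hypothesis gconvex : forall i (t : R) x y, 0 <= t -> t <= 1 ->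
  g i (t *: x + (1 - t) *: y) <= t * g i x + (1 - t) * g i y.

Let phi i := g i \o f.
Let A := sublevel_system phi.
Let r i x := composite_dirder f (g i) x.

Lemma sublevel_closed : closed A.
Proof.
have -> : A = \bigcap_(i in setT) [set x | phi i x <= 0].
  by apply/seteqP; split=> x h i; [move=> _; exact: h|exact: h].
apply: closed_bigI => i _.
by apply: (@closed_comp _ _ (phi i) [set t : R | t <= 0]) => [x _|];
  [exact: phi_cont|exact: closed_le].
Qed.

Lemma error_bound_of_multipliers (xbar : X) (eta delta : R) :
  A xbar -> 0 < eta -> 0 < delta ->
  (forall x, A x -> ball xbar delta x -> forall L : {linear X -> R^o},
    frechet_normal_cone A x L -> dual_unit_ball L ->
    exists2 lambda : 'I_m -> R,
      forall i, active phi x i -> 0 <= lambda i <= eta &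
      weighted_sum (active phi x) lambda (fun i => frechet_subdiff (phi i) x) L) ->
  local_error_bound phi xbar.
Proof.
move=> Axb eta0 delta0 H.
(* The [m] linearization errors [eta * (e * |x - a|)] then sum to at most [|x - a| / 4]. *)
pose e := (4 * eta * (m%:R + 1))^-1.
have m0 : 0 <= m%:R :> R by [].
have m1 : 0 < m%:R + 1 :> R by rewrite ltr_wpDl.
have e0 : 0 < e by rewrite invr_gt0 !mulr_gt0.
have [d d0 hd] : exists2 d : R, 0 < d & forall a b, `|a - xbar| < d ->
    `|b - xbar| < d -> forall i, r i a (b - a) <= phi i b - phi i a + e * `|b - a|.
  have [i|D DP] := @choice 'I_m R (fun i d => 0 < d /\ forall a b, `|a - xbar| < d ->
    `|b - xbar| < d -> r i a (b - a) <= phi i b - phi i a + e * `|b - a|).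
    have [d d0 hd] := composite_dirder_uniform C1f (@gcont i) (@gconvex i) xbar e0.
    by exists d.
  have [i|d d0 hd] := @common_radius R 'I_m (fun i t => t < D i).
    by have [Di0 _] := DP i; exists (D i).
  have d20 : 0 < d / 2 by rewrite divr_gt0.
  exists (d / 2) => // a b ad bd i; have [_] := DP i; apply.
    by apply: lt_trans ad _; apply: hd => //; lra.
  by apply: lt_trans bd _; apply: hd => //; lra.
pose d' := Num.min d delta; have d'0 : 0 < d' by rewrite lt_min d0.
(* With [b = 3 / 4] and errors of [|x - a| / 4], half of [|x - a|] is bounded by [eta] times the
   violation. Also [3 / 4 * |x - a| < d' / 4] places [a] within [d'] of [xbar]. *)
exists (2 * eta), (d' / 4); split; rewrite ?mulr_gt0 ?divr_gt0 // => x.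
rewrite -ball_normE /= distrC => xd.
have d'd : d' <= d by rewrite ge_min lexx.
have d'delta : d' <= delta by rewrite ge_min lexx orbT.
have sum0 : 0 <= \sum_(i < m) Num.max (phi i x) 0.
  by apply: sumr_ge0 => i _; rewrite le_max lexx orbT.
have [Ax|nAx] := pselect (A x).
  apply: (@le_trans _ _ 0); last by rewrite !mulr_ge0 // ltW.
  by apply: le_trans (dist_le x Ax) _; rewrite subrr normr0.
have b0 : 0 < 3 / 4 :> R by lra.
have b1 : 3 / 4 < 1 :> R by lra.
have [a [l [Aa lB ln lx ax]]] :=
  approximate_projection asplundX sublevel_closed Axb nAx b0 b1.
have axb : `|a - xbar| < d'.
  have := ler_normD (a - x) (x - xbar); rewrite addrA subrK [`|a - x|]distrC; lra.
have [L LE] := is_linear_pack (dual_ball_linear lB).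
have LB : dual_ball (L : X -> R).
  by split=> [|v]; [exact: linear_is_linear|rewrite LE; exact: lB.2].
have LB' := (dual_unit_ballP L).2 LB.
have Ba : ball xbar delta a.
  by rewrite -ball_normE /= distrC; exact: lt_le_trans axb d'delta.
have [|lam lam0 [u uP uE]] := H a Aa Ba L _ LB'.
  apply/frechet_normal_coneP; split; first by case: LB'.
  move=> c c0; have [d1 d10 hd1] := ln c c0; exists d1 => // y Ay ya.
  by rewrite LE; exact: hd1.
apply: le_trans (dist_le x Aa) _.
have ub i : active phi a i -> lam i * u i (x - a) <=
    eta * (Num.max (phi i x) 0 + e * `|x - a|).
  move=> ai; have /andP[l0 l1] := lam0 i ai.
  have /frechet_subdiffP[_ sub] := uP i ai.
  have := composite_subgradient_le C1f (@gcont i) (@gconvex i)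
    (linear_is_linear (u i)) sub (x - a).
  have pa : phi i a = 0 by apply/eqP.
  have xd' : `|x - xbar| < d by lra.
  have ad' : `|a - xbar| < d by lra.
  have := hd a x ad' xd' i; rewrite pa subr0 => h1 h2.
  have h3 : u i (x - a) <= Num.max (phi i x) 0 + e * `|x - a|.
    apply: le_trans h2 (le_trans h1 _); rewrite lerD2r le_max lexx //.
  apply: le_trans (ler_wpM2l l0 h3) _; apply: ler_wpM2r => //.
  by rewrite addr_ge0 ?le_max ?lexx ?orbT // mulr_ge0 // ltW.
have : L (x - a) <= \sum_(i < m) eta * (Num.max (phi i x) 0 + e * `|x - a|).
  rewrite uE [leRHS](bigID (active phi a)) /=.
  apply: le_trans (ler_sum _ ub) _; rewrite lerDl; apply: sumr_ge0 => i _.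
  rewrite mulr_ge0 ?ltW // ltr_wpDl ?le_max ?lexx ?orbT // mulr_gt0 //.
  by rewrite normr_gt0 subr_eq0; apply/eqP => xa; apply: nAx; rewrite xa.
rewrite -mulr_sumr big_split /= sumr_const card_ord -[_ *+ m]mulr_natl LE.
have em : eta * (m%:R * (e * `|x - a|)) <= `|x - a| / 4.
  have -> : eta * (m%:R * (e * `|x - a|)) = `|x - a| / 4 * (m%:R / (m%:R + 1)).
    by rewrite /e; field; rewrite !gt_eqF.
  by rewrite ler_piMr ?divr_ge0 // ler_pdivrMr // mul1r lerDl.
rewrite mulrDr; lra.
Qed.

End sufficiency.

Theorem theorem4p2 (R : realType) (X Y : completeNormedModType R)
  (asplundX : asplund X) (asplundY : asplund Y)
  (f : X -> Y) (C1f : C1 f)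
  (m : nat) (g : 'I_m -> Y -> R)
  (gcont : forall i, continuous (g i))
  (gconvex : forall i, convex_on_space (g i))
  (phi : 'I_m -> X -> R) (phiE : forall i, phi i = g i \o f)
  (A : set X) (AE : A = sublevel_system phi) (A0 : A !=set0)
  (xbar : X) (Axbar : A xbar) :
  local_error_bound phi xbar <->
  exists eta delta : R, [/\ 0 < eta, 0 < delta &
    forall x, A x -> ball xbar delta x ->
    forall xs : {linear X -> R^o},
      frechet_normal_cone A x xs -> dual_unit_ball xs ->
      exists2 lambda : 'I_m -> R,
        forall i, active phi x i -> 0 <= lambda i <= eta &
        weighted_sum (active phi x) lambda
          (fun i => frechet_subdiff (phi i) x) xs].
Proof.
have gc i := (convexP (g i)).1 (gconvex i).
have {phiE} E : phi = fun i => g i \o f by apply/funext.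
subst phi A; split=> [[eta [delta [eta0 delta0 EB]]]|[eta [delta [eta0 delta0 H]]]].
  exists eta, delta; split => // x Ax Bx L Ln LB.
  exact: (multipliers C1f gcont gc eta0 EB).
exact: (error_bound_of_multipliers asplundX C1f gcont gc Axbar eta0 delta0 H).
Qed.
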